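(* Let $n\ge 2$ and $\varepsilon\in\{1,-1\}$ be such that either $n$ is odd and $\varepsilon=-1$, or $n$ is even and $\varepsilon=+1$ (the split types). Let $M^0=\bigoplus_{i=1}^n M_i$ be a finite-dimensional graded complex vector space endowed with a $\sigma$-compatible $\varepsilon$-form $\langle-,-\rangle$, and let $M,N\in R(M^0;\langle-,-\rangle)$ be two $\varepsilon$-representations of $\overrightarrow{A}_n$. Then the following are equivalent: \begin{enumerate} \item $M\le_{\deg}^{\varepsilon}N$; \item $M\le_c^{\varepsilon}N$; \item $r^M\ge r^N$. \end{enumerate}
   Context: The base field is $\mathbb{C}$. $\overrightarrow{A}_n$ is the quiver $1\to 2\to\cdots\to n$ and $\sigma(i)=n+1-i$. A $\sigma$-compatible $\varepsilon$-form on $M^0$ is a non-degenerate bilinear form with $\langle v,w\rangle=\varepsilon\langle w,v\rangle$ whose restriction to $M_i\times M_j$ is zero unless $j=\sigma(i)$. Let $R(M^0)=\prod_{i=1}^{n-1}\mathrm{Hom}(M_i,M_{i+1})$, and let $R(M^0;\langle-,-\rangle)$ be the subset of those $(f_i)_i$ with $\langle f_i(v),w\rangle+\langle v,f_{\sigma(i+1)}(w)\rangle=0$ for all $1\le i\le n-1$, $v\in M_i$, $w\in M_{\sigma(i+1)}$; its elements are the $\varepsilon$-representations with underlying space $(M^0,\langle-,-\rangle)$. The isometry group $\mathrm{GL}^\bullet(M^0,\langle-,-\rangle)=\{g\in\prod_i\mathrm{GL}(M_i)\mid \langle gv,gw\rangle=\langle v,w\rangle\ \forall v,w\in M^0\}$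 acts on it by change of basis. Orders: - $M\le_{\deg}^\varepsilon N$ means $N\in\overline{\mathrm{GL}^\bullet(M^0,\langle-,-\rangle)\cdot M}$. - $r^M_{i,j}$ ($i\le j$) is the rank of the composite map $M_i\to M_j$ of the representation $M$ (with $r^M_{i,i}=\dim M_i$); $r^M\ge r^N$ means $r^M_{i,j}\ge r^N_{i,j}$ for all $1\le i\le j\le n$ (and $r^M_{i,i}=r^N_{i,i}$). - For $1\le i\le j\le n$ let $U_{i,j}$ (also called the segment $[i,j]$) be the indecomposable representation with $\mathbb{C}$ at the vertices $i,\dots,j$, zero elsewhere, and identity maps between consecutive copies of $\mathbb{C}$. Every representation is, uniquely up to reordering, a direct sum of such segments. In the split types the indecomposable $\varepsilon$-representations are, as representations, the $U_{i,j}\oplus U_{\sigma(j),\sigma(i)}$, so every $\varepsilon$-representation is a direct sum of such symmetric segments $[i,j]\cup[\sigma(j),\sigma(i)]$. - A symmetric cut at column $q$ ($1\le t\le q<s\le n$) of a symmetric segment $[t,s]\cup[\sigma(s),\sigma(t)]$ in $M\cong U_{t,s}\oplus U_{\sigma(s),\sigma(t)}\oplus M'$ ($M'$ an $\varepsilon$-representation) replaces $M$ by $U_{t,q}\oplus U_{q+1,s}\oplus U_{\sigma(s),\sigma(q+1)}\oplus U_{\sigma(q),\sigma(t)}\oplus M'$. - A symmetric shift, for $1\le t<q\le r<s\le n$, replaces $M\cong U_{t,s}\oplus U_{\sigma(s),\sigma(t)}\oplus U_{q,r}\oplus U_{\sigma(r),\sigma(q)}\oplus M'$ ($M'$ an $\varepsilon$-representation)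 by $U_{t,r}\oplus U_{q,s}\oplus U_{\sigma(r),\sigma(t)}\oplus U_{\sigma(s),\sigma(q)}\oplus M'$. - $M\le_c^\varepsilon N$ means that $N$ is obtained, up to isomorphism, from $M$ by a finite (possibly empty) sequence of symmetric cuts and symmetric shifts. *)

(* Defs.v *)
From HB Require Import structures.
From mathcomp Require Import all_boot all_order all_algebra.
From mathcomp Require Import sesquilinear reals complex.
Set Implicit Arguments.
Unset Strict Implicit.
Unset Printing Implicit Defensive.
Import GRing.Theory.
Local Open Scope ring_scope.

(* Vertices are natural numbers, as in the quiver 1 -> 2 -> ... -> n.  Families
   are indexed by all of nat, which keeps the maps V i -> V i.+1 free of casts;
   only the vertices 1 <= i <= n and the arrows 1 <= i < n are ever looked at,
   and whatever a family does elsewhere is irrelevant to every notion below. *)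
Section Representations.
Variables (F : fieldType) (n : nat).

Definition sigma (i : nat) : nat := (n.+1 - i)%N.

(* The summands M_i of a graded space M^0. *)
Definition gspace := nat -> vectType F.

(* A point of R(M^0) = \prod_(1 <= i < n) Hom(M_i, M_(i+1)). *)
Definition repvar (V : gspace) := forall i, 'Hom(V i, V i.+1).

(* An element of M^0 = (+)_i M_i, given by its components. *)
Definition gvect (V : gspace) := forall i, V i.

(* A bilinear form on M^0, given by its restrictions to the M_i x M_j. *)
Definition gform (V : gspace) :=
  forall i j, {bilinear V i -> V j -> F | *%R & *%R}.

Definition form_val (V : gspace) (b : gform V) (v w : gvect V) : F :=
  \sum_(1 <= i < n.+1) \sum_(1 <= j < n.+1) b i j (v i) (w j).

Definition compatible_form (eps : F) (V : gspace) (b : gform V) : Prop :=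
  [/\ forall v, (forall w, form_val b v w = 0) ->
        forall i, (1 <= i <= n)%N -> v i = 0,
      forall v w, form_val b v w = eps * form_val b w v
    & forall i j, (1 <= i <= n)%N -> (1 <= j <= n)%N -> j <> sigma i ->
        forall (x : V i) (y : V j), b i j x y = 0].

(* Note that (sigma i.+1).+1 = sigma i for 1 <= i < n. *)
Definition in_repform (V : gspace) (b : gform V) (f : repvar V) : Prop :=
  forall i, (1 <= i < n)%N -> forall (v : V i) (w : V (sigma i.+1)),
    b i.+1 (sigma i.+1) (f i v) w
    + b i (sigma i.+1).+1 v (f (sigma i.+1) w) = 0.

Definition isometry_group (V : gspace) (b : gform V)
    (g : forall i, 'End(V i)) : Prop :=
  (forall i, (1 <= i <= n)%N -> bijective (g i)) /\
  (forall v w : gvect V,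
     form_val b (fun i => g i (v i)) (fun i => g i (w i)) = form_val b v w).

Definition base_change (V : gspace) (g : forall i, 'End(V i)) (f : repvar V) :
  repvar V := fun i => (g i.+1 \o f i \o (g i)^-1)%VF.

Definition isometry_orbit (V : gspace) (b : gform V) (f : repvar V) :
  repvar V -> Prop := fun h => exists2 g, isometry_group b g & h = base_change g f.

(* Polynomial functions on the affine space R(M^0), coordinate free: the algebra
   of functions generated by the linear functionals on the Hom(M_i, M_(i+1)). *)
Inductive polyfun (V : gspace) : (repvar V -> F) -> Prop :=
| polyfun_cst (c : F) : polyfun (fun=> c)
| polyfun_lin i (l : {linear 'Hom(V i, V i.+1) -> F | *%R}) :
    (1 <= i < n)%N -> polyfun (fun f => l (f i))
| polyfun_add p q : polyfun p -> polyfun q -> polyfun (fun f => p f + q f)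
| polyfun_mul p q : polyfun p -> polyfun q -> polyfun (fun f => p f * q f).

Definition zariski_closure (V : gspace) (S : repvar V -> Prop) :
    repvar V -> Prop :=
  fun f => forall p, polyfun p -> (forall h, S h -> p h = 0) -> p f = 0.

Definition le_deg (V : gspace) (b : gform V) (M N : repvar V) : Prop :=
  zariski_closure (isometry_orbit b M) N.

Fixpoint path_map (V : gspace) (f : repvar V) (i k : nat) : 'Hom(V i, V (k + i)%N) :=
  match k with
  | 0 => \1%VF
  | k'.+1 => (f (k' + i)%N \o path_map f i k')%VF
  end.

Definition path_rank (V : gspace) (f : repvar V) (i j : nat) : nat :=
  \dim (limg (path_map f i (j - i))).

Definition rank_ge (V : gspace) (M N : repvar V) : Prop :=
  (forall i j, (1 <= i)%N -> (i <= j)%N -> (j <= n)%N ->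
     (path_rank N i j <= path_rank M i j)%N) /\
  (forall i, (1 <= i <= n)%N -> path_rank M i i = path_rank N i i).

Record qrep := QRep { qspace : gspace; qmap : repvar qspace }.

Definition qiso (X Y : qrep) : Prop :=
  exists2 phi : forall i, 'Hom(qspace X i, qspace Y i),
    forall i, (1 <= i <= n)%N -> bijective (phi i)
  & forall i, (1 <= i < n)%N ->
      (phi i.+1 \o qmap X i)%VF = (qmap Y i \o phi i)%VF.

Definition qsum (X Y : qrep) : qrep :=
  @QRep (fun i => (qspace X i * qspace Y i)%type : vectType F)
        (fun i => linfun (fun x : qspace X i * qspace Y i =>
                            (qmap X i x.1, qmap Y i x.2))).

(* The space at i is F^1 if t <= i <= s and F^0 otherwise, so that [pid_mx 1]
   is the 1 x 1 identity inside the segment. *)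
Definition segment (t s : nat) : qrep :=
  @QRep (fun i => 'rV[F]_(nat_of_bool (t <= i <= s)%N) : vectType F)
        (fun i => linfun (fun x : 'rV[F]_(nat_of_bool (t <= i <= s)%N) =>
             x *m pid_mx 1 : 'rV[F]_(nat_of_bool (t <= i.+1 <= s)%N))).

Definition is_eps_rep (eps : F) (X : qrep) : Prop :=
  exists2 b : gform (qspace X), compatible_form eps b & in_repform b (qmap X).

Local Notation U := segment.
Local Notation "X (+) Y" := (qsum X Y) (at level 50, left associativity).

Definition symmetric_cut (eps : F) (X Y : qrep) : Prop :=
  exists t q s (Z : qrep),
    [/\ [/\ (1 <= t)%N, (t <= q)%N, (q < s)%N & (s <= n)%N],
        is_eps_rep eps Z,
        qiso X (U t s (+) U (sigma s) (sigma t) (+) Z)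
      & qiso Y (U t q (+) U q.+1 s (+) U (sigma s) (sigma q.+1)
                (+) U (sigma q) (sigma t) (+) Z)].

Definition symmetric_shift (eps : F) (X Y : qrep) : Prop :=
  exists t q r s (Z : qrep),
    [/\ [/\ (1 <= t)%N, (t < q)%N, (q <= r)%N, (r < s)%N & (s <= n)%N],
        is_eps_rep eps Z,
        qiso X (U t s (+) U (sigma s) (sigma t)
                (+) U q r (+) U (sigma r) (sigma q) (+) Z)
      & qiso Y (U t r (+) U q s (+) U (sigma r) (sigma t)
                (+) U (sigma s) (sigma q) (+) Z)].

Inductive le_c (eps : F) : qrep -> qrep -> Prop :=
| le_c_iso X Y : qiso X Y -> le_c eps X Y
| le_c_cut X Y Z : symmetric_cut eps X Y -> le_c eps Y Z -> le_c eps X Z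
| le_c_shift X Y Z : symmetric_shift eps X Y -> le_c eps Y Z -> le_c eps X Z.

End Representations.

(* Main.v *)
Require Import Defs.
From HB Require Import structures.
From mathcomp Require Import all_boot all_order all_algebra.
From mathcomp Require Import sesquilinear reals complex.
From mathcomp Require Import zify ring.
From mathcomp Require boolp.
Set Implicit Arguments.
Unset Strict Implicit.
Unset Printing Implicit Defensive.
Import GRing.Theory.
Import VectorInternalTheory.
(* Makes [path_map] denote [Defs.path_map] again instead of [path.path_map]. *)
Import Defs.
Local Open Scope ring_scope.
Local Open Scope complex_scope.

(** A degeneration lowers the ranks of the composites, since a rank being at
    least [k] is a nonvanishing condition on polynomials.

    Conversely, an epsilon-representation of split type is determined up to
    isomorphism by its ranks, and these are the counting functions of a symmetric
    multisegment.  If [r^M > r^N] somewhere, let [(t, s)] be a longest pair with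
    [r^M_(t,s) > r^N_(t,s)]; then [t,s] is a segment of [M].  Among the segments
    (or cut points) [q,r] for which the shift lowers only ranks that exceed those
    of [N], take one bounding a minimal rectangle of pairs.  Its mirror image may
    overlap it, but minimality and the evenness of the ranks [r_(i,sigma i)] show
    that on the overlap the excess is at least 2.  So the symmetric shift or cut
    stays above [N], and one concludes by induction.

    Finally a cut or shift is the limit at [l = 0] of a line of representations on
    one space with form which for [l != 0] are all isomorphic to [M].  Isomorphic
    representations with forms are isometric: if [Phi] is an isomorphism, divide it
    by a square root of [Phi^* Phi] which is a polynomial in [Phi^* Phi].  Hence
    the line lies in the orbit of [M] away from [l = 0]. *)

(** * Linear maps and ranks *)

(** Ranks are the currency throughout: splitting off segments, comparing the two ends of a move and
    identifying the members of a family all reduce to arithmetic with counting functions. The parity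
    used against the overlap comes from the split types: the path from the vertex i to [sigma i]
    consists of k = n + 1 - 2 i skew-adjoint arrows, so exchanging v and w in <f^k v, w> produces
    the sign eps (-1)^k = -1. In the degenerations only one half X of a symmetric move is deformed
    by hand; the other half is the dual of X, and the form is hyperbolic on the two halves plus the
    given form on the complement. A cut is handled as the shift whose inner segment is the empty one
    [q + 1, q]. *)

Section LinearAlgebra.
Variable F : fieldType.
Implicit Types A B C D : vectType F.

Lemma linear_linfunE A B (f : A -> B) : linear f -> linfun f =1 f.
Proof.
move=> f_lin.
exact: (lfunE (HB.pack_for {linear A -> B} f (GRing.isLinear.Build _ _ _ _ f f_lin))).
Qed.

(** The opaque proof hides the matrix behind [linfun]: simplification stops at [mklfun], and only
    [mklfunE] computes it. *)
Fact mklfun_subproof A B (f : A -> B) :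
  linear f -> {g : 'Hom(A, B) | forall x, g x = f x}.
Proof. by move=> f_lin; exists (linfun f); apply: linear_linfunE. Qed.

Definition mklfun A B (f : A -> B) (f_lin : linear f) : 'Hom(A, B) :=
  sval (mklfun_subproof f_lin).

Lemma mklfunE A B (f : A -> B) (f_lin : linear f) x : mklfun f_lin x = f x.
Proof. exact: (svalP (mklfun_subproof f_lin)). Qed.

Lemma v2r_lfun A B (f : 'Hom(A, B)) x : v2r (f x) = v2r x *m f2mx f.
Proof. by rewrite unlock /= r2vK. Qed.

Lemma f2mx_eq A B (f : 'Hom(A, B)) M :
  (forall x, v2r (f x) = v2r x *m M) -> f2mx f = M.
Proof.
move=> fM; apply/row_matrixP => i; rewrite !rowE.
by rewrite -[delta_mx 0 i]r2vK -v2r_lfun fM.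
Qed.

Lemma f2mx_comp A B C (f : 'Hom(A, B)) (g : 'Hom(B, C)) :
  f2mx (g \o f)%VF = f2mx f *m f2mx g.
Proof. by apply: f2mx_eq => x; rewrite comp_lfunE !v2r_lfun mulmxA. Qed.

Lemma dim_limg A B (f : 'Hom(A, B)) : \dim (limg f) = \rank (f2mx f).
Proof.
have -> : limg f = mx2vs (vs2mx (fullv : {vspace A}) *m f2mx f).
  by rewrite -[RHS]/(lfun_img_def f fullv) unlock.
by rewrite /dimv mx2vsK (eqmxMr _ (mx2vsK _)) mul1mx.
Qed.

Lemma lin1_mx_inv m A (h : {linear A -> 'rV[F]_m}) :
  bijective h -> row_free (lin1_mx (h \o r2v)) && row_full (lin1_mx (h \o r2v)).
Proof.
case=> h' hK h'K; apply/andP; split.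
  apply: inj_row_free => v; rewrite mul_rV_lin1 /= => /(congr1 h').
  rewrite hK -(linear0 h) hK => /(congr1 v2r); by rewrite r2vK linear0.
apply/row_fullP; exists (\matrix_i v2r (h' (delta_mx 0 i))).
apply/row_matrixP => i; rewrite row_mul rowK mul_rV_lin1 /= v2rK h'K.
by rewrite row1.
Qed.

(** The coordinates are free, so that a product of spaces can be measured in the concatenated
    coordinates of its factors. *)
Lemma limg_rank m n A B (f : 'Hom(A, B)) (M : 'M_(m, n))
    (a : {linear A -> 'rV[F]_m}) (b : {linear B -> 'rV[F]_n}) :
  bijective a -> bijective b -> (forall x, b (f x) = a x *m M) ->
  \dim (limg f) = \rank M.
Proof.
move=> /lin1_mx_inv/andP[afree afull] /lin1_mx_inv/andP[bfree bfull] fM.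
rewrite dim_limg -(mxrankMfree _ bfree) -(eqmxMfull _ afull).
congr (\rank _); apply/row_matrixP => i; rewrite !rowE !mulmxA.
rewrite !mul_rV_lin1 /= -fM; congr (b _).
by apply: v2r_inj; rewrite v2r_lfun !r2vK.
Qed.

Lemma bij_row_free A B (f : 'Hom(A, B)) :
  bijective f -> row_free (f2mx f) && row_full (f2mx f).
Proof.
case=> g fK gK; have vB : bijective (v2r : B -> _).
  by apply: (@Bijective _ _ _ r2v); [apply: v2rK | apply: r2vK].
have bb : bijective ((v2r : {linear B -> _}) \o f).
  by apply: bij_comp => //; exists g.
have /= := lin1_mx_inv bb.
suff -> : lin1_mx (((v2r : {linear B -> _}) \o f) \o r2v) = f2mx f by [].
by apply/row_matrixP => i; rewrite !rowE mul_rV_lin1 /= v2r_lfun r2vK.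
Qed.

Lemma row_free_bij A B (f : 'Hom(A, B)) :
  row_free (f2mx f) -> row_full (f2mx f) -> bijective f.
Proof.
move=> /row_freeP[M fM] /row_fullP[N Nf].
have MN : M = N by rewrite -[N]mulmx1 -fM mulmxA Nf mul1mx.
exists (fun y => r2v (v2r y *m M)) => x.
  by rewrite v2r_lfun -mulmxA fM mulmx1 v2rK.
by apply: v2r_inj; rewrite v2r_lfun r2vK -mulmxA MN Nf mulmx1.
Qed.

Lemma limg_conj A B C D (f : 'Hom(A, B)) (g : 'Hom(C, D))
   (a : 'Hom(A, C)) (b : 'Hom(B, D)) :
  bijective a -> bijective b -> (forall x, b (f x) = g (a x)) ->
  \dim (limg f) = \dim (limg g).
Proof.
move=> /bij_row_free/andP[_ afull] /bij_row_free/andP[bfree _] fg.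
rewrite !dim_limg -(mxrankMfree _ bfree) -(eqmxMfull (f2mx g) afull) -!f2mx_comp.
by congr (\rank (f2mx _)); apply/lfunP => x; rewrite !comp_lfunE.
Qed.

Lemma limg_pair A B C D (f : 'Hom(A, B)) (g : 'Hom(C, D))
    (h : 'Hom((A * C)%type, (B * D)%type)) :
  (forall x y, h (x, y) = (f x, g y)) ->
  \dim (limg h) =
    (\dim (limg f) + \dim (limg g))%N.
Proof.
move=> hE.
pose rp (X Y : vectType F) := fun u : X * Y => row_mx (v2r u.1) (v2r u.2).
have rp_lin X Y : linear (@rp X Y).
  by move=> k u v; rewrite /rp !linearP /= scale_row_mx add_row_mx.
pose rpL X Y : {linear _ -> _} := HB.pack (@rp X Y)
  (GRing.isLinear.Build _ _ _ _ (@rp X Y) (@rp_lin X Y)).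
have rp_bij X Y : bijective (rpL X Y).
  exists (fun w => (r2v (lsubmx w), r2v (rsubmx w))).
    by case=> x y; rewrite /= /rp row_mxKl row_mxKr !v2rK.
  by move=> w; rewrite /= /rp /= !r2vK hsubmxK.
rewrite (limg_rank (M := block_mx (f2mx f) 0 0 (f2mx g)) (rp_bij _ _) (rp_bij _ _)).
  by rewrite rank_diag_block_mx !dim_limg.
case=> x y; rewrite hE /= /rp /= mul_row_block !mulmx0 addr0 add0r.
by rewrite !v2r_lfun.
Qed.

Lemma limg_mulmxr m n (M : 'M[F]_(m, n)) (f : 'Hom('rV[F]_m, 'rV[F]_n)) :
  (forall x, f x = x *m M) -> \dim (limg f) = \rank M.
Proof.
move=> fM.
by rewrite (limg_rank (M := M) (a := idfun) (b := idfun)) //; exists id.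
Qed.

End LinearAlgebra.

(** * Representations and their ranks *)

Section SegmentRanks.
Variable n : nat.

Definition seg_rk (t s i j : nat) : nat := ((t <= i) && (j <= s))%N.

Definition sym_rk (p : nat * nat) i j : nat :=
  (seg_rk p.1 p.2 i j + seg_rk (sigma n p.2) (sigma n p.1) i j)%N.

Lemma seg_rk_sigma t s i j : (t <= n)%N -> (s <= n)%N -> (i <= n)%N -> (j <= n)%N ->
  seg_rk t s (sigma n j) (sigma n i) = seg_rk (sigma n s) (sigma n t) i j.
Proof.
rewrite /seg_rk /sigma => tn sn iN jn; congr nat_of_bool.
have -> : (t <= n.+1 - j)%N = (j <= n.+1 - t)%N by lia.
have -> : (n.+1 - i <= s)%N = (n.+1 - s <= i)%N by lia.
exact: andbC.
Qed.

Lemma sym_rk_empty q i j : (q < n)%N -> (i <= j)%N -> sym_rk (q.+1, q) i j = 0%N.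
Proof. by rewrite /sym_rk /seg_rk /sigma /=; lia. Qed.

End SegmentRanks.

Section Representations.
Variables (F : fieldType) (n : nat).
Implicit Types (X Y Z : qrep F) (V W : gspace F).

(* Quantifying over a family [mu] avoids a cast between [V (k + i.+1)] and
   [V (k.+1 + i)]. *)
Lemma path_map_front V (f : repvar V) T (mu : forall l, V l -> T) k i x :
  mu _ (path_map f i k.+1 x) = mu _ (path_map f i.+1 k (f i x)).
Proof.
elim: k mu => [|k IH] mu.
  by rewrite /= comp_lfunE !id_lfunE.
by have := IH (fun l y => mu l.+1 (f l y)); rewrite /= !comp_lfunE.
Qed.

Lemma path_map_nat X Y (phi : forall i, 'Hom(qspace X i, qspace Y i)) :
  (forall i, (1 <= i < n)%N -> (phi i.+1 \o qmap X i)%VF = (qmap Y i \o phi i)%VF) ->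
  forall i k x, (1 <= i)%N -> (k + i <= n)%N ->
  phi (k + i)%N (path_map (qmap X) i k x) = path_map (qmap Y) i k (phi i x).
Proof.
move=> phiE i; elim=> [|k IH] x i1 kin; first by rewrite /= !id_lfunE.
rewrite /= !comp_lfunE -IH //; last by apply: leq_trans kin; rewrite addSn.
have /phiE/lfunP/(_ (path_map (qmap X) i k x)) : (1 <= k + i < n)%N by lia.
by rewrite !comp_lfunE.
Qed.

Definition rk X i j := path_rank (qmap X) i j.

Lemma qiso_rk X Y i j : qiso n X Y -> (1 <= i)%N -> (i <= j)%N -> (j <= n)%N ->
  rk X i j = rk Y i j.
Proof.
move=> [phi phi_bij phiE] i1 ij jn; rewrite /rk /path_rank.
apply: (limg_conj (a := phi i) (b := phi _)).
- by apply: phi_bij; lia.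
- by apply: phi_bij; lia.
- by move=> x; apply: path_map_nat => //; lia.
Qed.

Lemma qiso_refl X : qiso n X X.
Proof.
exists (fun i => \1%VF) => i _; last by rewrite comp_lfun1l comp_lfun1r.
by exists (\1%VF) => x; rewrite !id_lfunE.
Qed.

Lemma lfun_bijK (A B : vectType F) (f : 'Hom(A, B)) :
  bijective f -> cancel f (f^-1)%VF /\ cancel (f^-1)%VF f.
Proof.
move=> fb; have fK : cancel f (f^-1)%VF by apply/lker0_lfunK/lker0P/bij_inj.
by split=> //; apply/(bij_can_sym fb).
Qed.

Lemma qiso_sym X Y : qiso n X Y -> qiso n Y X.
Proof.
move=> [phi phi_bij phiE]; exists (fun i => ((phi i)^-1)%VF) => i iP.
  by have [pK Kp] := lfun_bijK (phi_bij i iP); exists (phi i).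
have [pK _] : _ /\ _ := lfun_bijK (phi_bij i.+1 ltac:(lia)).
have [_ Kp] : _ /\ _ := lfun_bijK (phi_bij i ltac:(lia)).
apply/lfunP => y; have /lfunP/(_ ((phi i)^-1%VF y)) := phiE i iP.
by rewrite !comp_lfunE Kp => <-; rewrite pK.
Qed.

Lemma qiso_trans X Y Z : qiso n X Y -> qiso n Y Z -> qiso n X Z.
Proof.
move=> [phi phi_bij phiE] [psi psi_bij psiE].
exists (fun i => (psi i \o phi i)%VF) => i iP.
  apply: (eq_bij (bij_comp (psi_bij i iP) (phi_bij i iP))).
  by move=> x; rewrite comp_lfunE.
by rewrite -comp_lfunA phiE // comp_lfunA psiE // comp_lfunA.
Qed.

Definition rsum V W (f : repvar V) (g : repvar W) :
    repvar (fun i => (V i * W i)%type : vectType F) :=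
  qmap (qsum (QRep f) (QRep g)).

Lemma rsumE V W (f : repvar V) (g : repvar W) i x :
  rsum f g i x = (f i x.1, g i x.2).
Proof. by apply: linear_linfunE => k u v; rewrite /= !linearP. Qed.

Lemma qsumE X Y i x : qmap (qsum X Y) i x = (qmap X i x.1, qmap Y i x.2).
Proof. by case: X Y x => [V f] [W g] x; apply: (rsumE f g). Qed.

Lemma qsum_path X Y i k x y :
  path_map (qmap (qsum X Y)) i k (x, y) =
    (path_map (qmap X) i k x, path_map (qmap Y) i k y).
Proof.
elim: k => [|k IH]; first by rewrite /= !id_lfunE.
by rewrite [path_map _ _ _]/= comp_lfunE IH qsumE /= !comp_lfunE.
Qed.

Lemma rk_sum X Y i j : rk (qsum X Y) i j = (rk X i j + rk Y i j)%N.
Proof. by apply: limg_pair => x y; apply: qsum_path. Qed.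

Lemma pair_lfun (A B C D : vectType F) (f : 'Hom(A, B)) (g : 'Hom(C, D)) :
  {h : 'Hom((A * C)%type, (B * D)%type) | forall x, h x = (f x.1, g x.2)}.
Proof.
have h_lin : linear (fun x : (A * C)%type => (f x.1, g x.2)).
  by move=> k u v; rewrite /= !linearP.
by exists (mklfun h_lin) => x; rewrite mklfunE.
Qed.

Lemma qiso_sum X X' Y Y' :
  qiso n X X' -> qiso n Y Y' -> qiso n (qsum X Y) (qsum X' Y').
Proof.
move=> [phi phi_bij phiE] [psi psi_bij psiE].
exists (fun i => sval (pair_lfun (phi i) (psi i))) => i iP.
  have [pK Kp] := lfun_bijK (phi_bij i iP).
  have [qK Kq] := lfun_bijK (psi_bij i iP).
  case: pair_lfun => h /= hE.
  exists (fun x => ((phi i)^-1%VF x.1, (psi i)^-1%VF x.2)) => x.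
    by rewrite hE /= pK qK -surjective_pairing.
  by rewrite hE /= Kp Kq -surjective_pairing.
case: pair_lfun => h /= hE; case: pair_lfun => h' /= hE'.
apply/lfunP => x; rewrite !comp_lfunE hE hE' !qsumE /=.
by rewrite -!comp_lfunE phiE // psiE // !comp_lfunE.
Qed.

Lemma segmentE t s i x :
  qmap (segment F t s) i x = x *m pid_mx 1.
Proof. exact: (lfunE (mulmxr _)). Qed.

(** The booleans tell which vertices lie in a segment, and the hypothesis is its convexity: between
    two nonzero ends the middle space must not vanish. *)
Lemma pid_bool_comp (a b c : bool) : (a -> c -> b) ->
  (pid_mx 1 : 'M[F]_(a, b)) *m (pid_mx 1 : 'M_(b, c)) = pid_mx 1.
Proof.
move=> abc; rewrite mul_pid_mx.
case: a b c abc => [] [] [] //= abc; rewrite ?pid_mx_0 //.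
  by have := abc isT isT.
all: by apply/matrixP => i j; move: (i) (j) => [] // ? ? [].
Qed.

Lemma pid_bool_id (b : bool) (x : 'rV[F]_b) : x *m pid_mx 1 = x.
Proof.
case: b x => x; first by rewrite pid_mx_1 mulmx1.
by apply/rowP => - [].
Qed.

Lemma segment_path t s i k x :
  path_map (qmap (segment F t s)) i k x = x *m pid_mx 1.
Proof.
elim: k => [|k IH]; first by rewrite /= id_lfunE; apply/esym/pid_bool_id.
by rewrite /= comp_lfunE IH segmentE -mulmxA pid_bool_comp //; lia.
Qed.

Lemma rk_segment t s i j : (i <= j)%N ->
  rk (segment F t s) i j = seg_rk t s i j.
Proof.
move=> ij; rewrite /seg_rk /rk /path_rank (limg_mulmxr (M := pid_mx 1)); last first.
  exact: segment_path.
rewrite subnK //.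
have -> : ((t <= i) && (j <= s) = (t <= i <= s) && (t <= j <= s))%N by lia.
by case: (t <= i <= s)%N; case: (t <= j <= s)%N;
  rewrite ?pid_mx_1 ?pid_mx_0 ?mxrank1 ?thinmx0 ?flatmx0 ?mxrank0.
Qed.

Lemma rk_diag X i : rk X i i = dim (qspace X i).
Proof.
rewrite /rk /path_rank subnn (_ : limg _ = fullv) ?dimvf //.
exact: lim1g.
Qed.

End Representations.

(** * Ranks determine a representation *)

Section RankInvariant.
Variables (F : fieldType) (n : nat).
Implicit Types (X Y Z U : qrep F) (V W : gspace F).

(** The complement is the kernel of [pi], stable under the arrows because [pi] is a morphism;
    [x - iota (pi x)] projects onto it. *)
Lemma retract_split X U
    (iota : forall i, 'Hom(qspace U i, qspace X i))
    (pi : forall i, 'Hom(qspace X i, qspace U i)) :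
  (forall i, (1 <= i < n)%N -> forall u,
     iota i.+1 (qmap U i u) = qmap X i (iota i u)) ->
  (forall i, (1 <= i < n)%N -> forall x,
     pi i.+1 (qmap X i x) = qmap U i (pi i x)) ->
  (forall i, (1 <= i <= n)%N -> cancel (iota i) (pi i)) ->
  exists Z, qiso n X (qsum U Z).
Proof.
move=> iotaE piE iotaK.
pose K i := lker (pi i).
exists (@QRep F (fun i => subvs_of (K i))
  (fun i => linfun (vsproj (K i.+1) \o (qmap X i \o vsval)))).
have comp_lin i : linear (fun x => (pi i x, vsproj (K i) (x - iota i (pi i x)))).
  move=> k x y; congr (_, _); first by rewrite linearP.
  rewrite /= -[RHS]linearP; congr (vsproj _ _).
  by rewrite !linearP scalerDr addrACA.
exists (fun i => mklfun (comp_lin i)) => i iP.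
  have piK : forall x, x - iota i (pi i x) \in K i.
    by move=> x; rewrite memv_ker linearB /= iotaK ?subrr.
  exists (fun u => iota i u.1 + vsval u.2) => [x|[u z]].
    by rewrite mklfunE /= vsprojK // addrC subrK.
  have /eqP z0 : pi i (vsval z) == 0 by rewrite -memv_ker subvsP.
  rewrite mklfunE /=; congr (_, _); first by rewrite linearD /= iotaK // z0 addr0.
  by rewrite [pi i _]linearD /= iotaK // z0 addr0 addrC addKr vsvalK.
apply/lfunP => x; rewrite !comp_lfunE !mklfunE qsumE /= piE //; congr (_, _).
rewrite linear_linfunE /= ?vsprojK; first last.
- by move=> k u v; rewrite /= !linearP.
- by rewrite memv_ker linearB /= iotaK ?subrr //; lia.
by rewrite [qmap X i (_ - _)]linearB /= iotaE.
Qed.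

Lemma dim0_eq (A : vectType F) (x : A) : dim A = 0%N -> x = 0.
Proof.
move=> A0; apply: v2r_inj; move: (v2r x) (v2r 0); rewrite A0 => y z.
by rewrite !thinmx0.
Qed.

(* As [i] is the first vertex of the support, a linear form on [X_j] pulled back
   along the paths to [j] is a retraction onto the segment spanned by a vector
   of [X_i] that dies exactly after the vertex [j]. *)
Lemma segment_split X i j : (1 <= i)%N -> (i <= j)%N -> (j <= n)%N ->
  (forall k, (1 <= k < i)%N -> rk X k k = 0%N) ->
  (0 < rk X i i)%N -> rk X i j = rk X i i ->
  ((j < n)%N -> (rk X i j.+1 < rk X i i)%N) ->
  exists Z, qiso n X (qsum (segment F i j) Z).
Proof.
move=> i1 ij jn X0 Xi rkj rkj1; case: X X0 Xi rkj rkj1 => V f /= X0 Xi rkj rkj1.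
(* At [i] this vector dies just after [j]; if [j = n] there is no later vertex and any nonzero
   vector will do. *)
pose v k := if (j < n)%N then vpick (lker (path_map f k (j.+1 - k)))
            else vpick (fullv : {vspace V k}).
pose x : forall k, V k := fix x k := match k return V k with
  | 0 => 0
  | k'.+1 => if (k'.+1 < i)%N then 0 else if k'.+1 == i then v k'.+1
             else f k' (x k') end.
have xS k : (i <= k)%N -> x k.+1 = f k (x k).
  by move=> ik; rewrite /= ifF ?ifF //; lia.
have xi : x i = v i.
  rewrite -(prednK i1) -/x /= ifF ?ifT //; lia.
clearbody x.
have xpath m k : (i <= k)%N -> path_map f k m (x k) = x (m + k)%N.
  move=> ik; elim: m => [|m IH]; first by rewrite /= id_lfunE.
  by rewrite [LHS]/= comp_lfunE IH -xS //; lia.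
have vi0 : v i != 0.
  rewrite /v; case: ifP => jn'; rewrite vpick0 -dimv_eq0.
    have := rkj1 jn'; rewrite rk_diag -dimvf {1}/rk /path_rank /=.
    have := limg_ker_dim (path_map f i (j.+1 - i)) fullv.
    by rewrite capfv; lia.
  by move: Xi; rewrite rk_diag /= dimvf; lia.
have xj k : (i <= k <= j)%N -> x k != 0.
  move=> /andP[ik kj]; apply: contraNneq vi0 => xk.
  have xj0 : x j = 0.
    by rewrite -(subnK kj) -xpath // xk linear0.
  rewrite -xi; apply/eqP; move: rkj; rewrite /rk /path_rank /= subnn.
  rewrite (_ : limg \1 = fullv); last exact: lim1g.
  have := limg_ker_dim (path_map f i (j - i)) fullv.
  rewrite capfv => kd rkj; have /eqP : \dim (lker (path_map f i (j - i))) = 0%N.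
    by move: kd; rewrite rkj => /(canRL (addnK _)); rewrite subnn.
  rewrite dimv_eq0 => /eqP k0; apply/eqP; rewrite -memv0 -k0 memv_ker xpath //.
  by rewrite subnK // xj0.
have xj1 k : (j < k)%N -> (k <= n)%N -> x k = 0.
  move=> jk kn; have jn' : (j < n)%N by lia.
  rewrite -(subnK jk) -xpath; last by lia.
  suff -> : x j.+1 = 0 by rewrite linear0.
  have ij1 : (i <= j.+1)%N by lia.
  rewrite -(subnK ij1) -xpath // xi; apply/eqP; rewrite -memv_ker.
  by rewrite /v jn' memv_pick.
(* The pseudo-inverse of the nonzero row of [x j] is a column on which that row takes the value 1,
   that is, a linear form normalised at [x j]. The index [j - k + k] is [j] without a cast. *)
pose lam k (y : V k) :=
  v2r (path_map f k (j - k) y) *m pinvmx (v2r (x (j - k + k)%N)).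
have lamS k y : (k < j)%N -> lam k.+1 (f k y) = lam k y.
  move=> kj; rewrite /lam.
  pose mu l (z : V l) := v2r z *m pinvmx (v2r (x l)).
  rewrite -[LHS]/(mu _ _) -[RHS]/(mu _ _).
  by rewrite -(path_map_front f mu) -subSn.
have lamx k : (i <= k <= j)%N -> lam k (x k) = 1%:M.
  move=> /andP[ik kj]; rewrite /lam xpath // mulmxVp //.
  rewrite /row_free rank_rV; suff -> : v2r (x (j - k + k)%N) != 0 by [].
  have : x (j - k + k)%N != 0 by apply: xj; lia.
  by apply: contraNneq => e; apply/eqP/v2r_inj; rewrite e linear0.
have iota_lin k : linear (fun c : 'rV[F]_(i <= k <= j)%N =>
    (c *m (pid_mx 1 : 'M_(_, 1))) 0 0 *: x k).
  move=> a c c'; rewrite mulmxDl -scalemxAl !mxE scalerDl scalerA //.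
have pi_lin k : linear (fun y : V k => lam k y *m (pid_mx 1 : 'M_(1, (i <= k <= j)%N))).
  by move=> a y y'; rewrite /lam !linearP !mulmxDl -!scalemxAl.
have bE k : (i <= k <= j)%N = true \/ (i <= k <= j)%N = false.
  by case: (i <= k <= j)%N; [left | right].
have b0 k (bk : (i <= k <= j)%N = false) (c : 'rV[F]_(i <= k <= j)%N) : c = 0.
  by move: c; rewrite bk => c; apply: thinmx0.
apply: (@retract_split (QRep f) (segment F i j)
   (fun k => mklfun (iota_lin k)) (fun k => mklfun (pi_lin k))) => k kn /=.
- move=> u; rewrite segmentE !mklfunE /= linearZ /= -mulmxA.
  have [bk|bk] := bE k; last first.
    by rewrite (b0 _ bk u) !mul0mx mxE !scale0r.
  have [kj|kj] : (k < j)%N \/ (j <= k)%N by lia.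
    by rewrite -xS ?(@pid_bool_comp F _ _ true) //; lia.
  by rewrite -xS ?xj1 ?scaler0 //; lia.
- move=> y; rewrite !mklfunE segmentE /=.
  have [bk1|bk1] := bE k.+1; last first.
    by rewrite [LHS](b0 _ bk1) [RHS](b0 _ bk1).
  have [bk|bk] := bE k.
    by rewrite lamS -?mulmxA ?(@pid_bool_comp F true) //; lia.
  (* Here [k.+1] lies in the segment and [k] does not, so [k.+1 = i] and the space at [k] is
     zero. *)
  have -> : y = 0.
    by apply: dim0_eq; rewrite -(@rk_diag F (QRep f)) X0 //; lia.
  by rewrite linear0 /lam !linear0 !mul0mx.
- move=> u; rewrite !mklfunE /=.
  have [bk|bk] := bE k; last by rewrite [LHS](b0 _ bk) [RHS](b0 _ bk).
  have -> a : lam k (a *: x k) = a%:M.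
    rewrite -scalemx1 -(lamx k) //.
    by rewrite /lam !linearZ /= -scalemxAl.
  rewrite -(mx11_scalar (u *m _)) -mulmxA (@pid_bool_comp F _ true) //.
  exact: pid_bool_id.
Qed.

Definition same_rk X Y := forall i j, (1 <= i)%N -> (i <= j)%N -> (j <= n)%N ->
  rk X i j = rk Y i j.

(** Take for i the first vertex of the support and for j the last one to which the path from i is
    injective. The splitting criterion reads only ranks, so the same segment splits off every Y with
    the ranks of X. *)
Lemma first_segment X i0 : (1 <= i0 <= n)%N -> rk X i0 i0 != 0%N ->
  exists i j, [/\ (1 <= i)%N, (i <= j)%N, (j <= n)%N
    & forall Y, same_rk X Y -> exists Z, qiso n Y (qsum (segment F i j) Z)].
Proof.
move=> i0P Xi0.
have [|i /andP[iP Xi] imin] := @ex_minnP (fun i => (1 <= i <= n)%N && (rk X i i != 0%N)).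
  by exists i0; rewrite Xi0 andbT; lia.
have [||j /andP[jP /eqP Xj] jmax] := @ex_maxnP
  (fun j => (i <= j <= n)%N && (rk X i j == rk X i i)) n.
- by exists i; rewrite eqxx; lia.
- by move=> j; lia.
have le_rk : (rk X i j.+1 <= rk X i i)%N.
  rewrite rk_diag -dimvf -(limg_ker_dim (path_map (qmap X) i (j.+1 - i)) fullv).
  exact: leq_addl.
have hX k : (1 <= k < i)%N -> rk X k k = 0%N.
  move=> kP; apply/eqP; rewrite -[_ == _]negbK; apply/negP => Xk.
  by have := imin k; rewrite Xk andbT; lia.
have hXj : (j < n)%N -> (rk X i j.+1 < rk X i i)%N.
  move=> jn; rewrite ltn_neqAle le_rk andbT; apply/negP => Xj1.
  by have := jmax j.+1; rewrite Xj1 andbT; lia.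
exists i, j; split; try lia.
move=> Y XY; apply: segment_split => //; try lia.
- by move=> k kP; rewrite -XY ?hX //; lia.
- by rewrite -XY; lia.
- by rewrite -!XY; lia.
- by move=> jn; rewrite -!XY ?hXj //; lia.
Qed.

Lemma rk_split X Z t s : (1 <= t)%N -> (t <= s)%N -> (s <= n)%N ->
  qiso n X (qsum (segment F t s) Z) ->
  (forall i j, (1 <= i)%N -> (i <= j)%N -> (j <= n)%N ->
    rk X i j = (seg_rk t s i j + rk Z i j)%N) /\
  (\sum_(1 <= i < n.+1) rk Z i i < \sum_(1 <= i < n.+1) rk X i i)%N.
Proof.
move=> t1 ts sn XZ.
have E i j : (1 <= i)%N -> (i <= j)%N -> (j <= n)%N ->
    rk X i j = (seg_rk t s i j + rk Z i j)%N.
  by move=> *; rewrite (qiso_rk XZ) // rk_sum rk_segment.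
split=> //; rewrite -subn_gt0.
rewrite [X in (_ < X - _)%N](eq_big_nat _ _ (F2 := fun k =>
   (seg_rk t s k k + rk Z k k)%N)); last by move=> k kP; rewrite E //; lia.
rewrite big_split /= addnK (bigD1_seq t) ?mem_index_iota ?iota_uniq //=; last by lia.
by rewrite /seg_rk leqnn ts.
Qed.

(** Induction on the total dimension: the same segment splits off both sides, and the complements
    again have equal ranks by subtraction. *)
Lemma qiso_of_rk X Y : same_rk X Y -> qiso n X Y.
Proof.
have [m] := ubnP (\sum_(1 <= i < n.+1) rk X i i)%N.
elim: m X Y => // m IH X Y /ltnSE leXm rkE.
have [X0|] := boolP (all (fun i => rk X i i == 0)%N (iota 1 n)).
  exists (fun i => 0) => i iP; last by rewrite comp_lfun0l comp_lfun0r.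
  have /allP/(_ i) := X0; rewrite mem_iota add1n => /(_ iP)/eqP Xi.
  have := Xi; rewrite rkE //; try lia.
  rewrite !rk_diag in Xi * => Yi.
  by exists (fun => 0) => x; rewrite ?zero_lfunE; apply: esym; apply: dim0_eq.
rewrite -has_predC => /hasP[i0]; rewrite mem_iota /= => i0P Xi0.
have [|i [j [i1 ij jn split_ij]]] := @first_segment X i0 _ Xi0; first by lia.
have [Z XZ] := split_ij X (fun _ _ _ _ _ => erefl).
have [Z' YZ'] := split_ij Y rkE.
have [rkX lt_ZX] := rk_split i1 ij jn XZ; have [rkY _] := rk_split i1 ij jn YZ'.
apply: (qiso_trans XZ); apply: qiso_sym; apply: (qiso_trans YZ').
apply: qiso_sum; first exact: qiso_refl.
apply: qiso_sym; apply: IH; first exact: leq_trans lt_ZX leXm.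
by move=> a c a1 ac cn; have := rkE a c; rewrite rkX // rkY //; lia.
Qed.

End RankInvariant.

(** * Bilinear forms and duality *)

Section SkewRank.
Variables (F : fieldType).

(** The product equals C G^T C^T for an invertible matrix G of size r; cancelling C shows that G is
    skew, and det G = (-1)^r det G forces r to be even. *)
Lemma odd_skew_factor n r (C : 'M[F]_(n, r)) (R : 'M_(r, n)) : 2%:R != 0 :> F ->
  row_free C^T -> row_free R -> (C *m R)^T = - (C *m R) -> ~~ odd r.
Proof.
move=> F2 /row_freeP[E CE] /row_freeP[D RD] skew.
pose G := - (R *m E).
have RT : R^T = C *m G.
  by rewrite mulmxN mulmxA -mulNmx -skew trmx_mul -mulmxA CE mulmx1.
have RE : R = G^T *m C^T by rewrite -trmx_mul -RT trmxK.
have EC : E^T *m C = 1%:M by rewrite -[C]trmxK -trmx_mul CE trmx1.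
have GT : G = - G^T.
  have : C *m G *m C^T = - (C *m G^T *m C^T).
    by rewrite -RT -trmx_mul skew {1}RE mulmxA.
  move/(congr1 (fun M => E^T *m M *m E)).
  rewrite !(mulmxN, mulNmx) !mulmxA EC !mul1mx -!mulmxA.
  by rewrite CE !mulmx1.
have Gu : G^T \in unitmx.
  rewrite -row_free_unit; apply/row_freeP; exists (C^T *m D).
  by rewrite mulmxA -RE.
apply/negP => rodd; move: Gu; rewrite unitmxE det_tr.
have : \det G = - \det G.
  rewrite {1}GT -scaleN1r detZ det_tr -signr_odd rodd expr1.
  by rewrite mulN1r.
move/eqP; rewrite -subr_eq0 opprK -mulr2n -mulr_natr mulf_eq0 (negbTE F2) orbF.
by move=> /eqP ->; rewrite unitr0.
Qed.

Lemma odd_rank_skew n (A : 'M[F]_n) : 2%:R != 0 :> F ->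
  A^T = - A -> ~~ odd (\rank A).
Proof.
move=> F2 Askew; apply: (odd_skew_factor (C := col_base A) (R := row_base A)) => //.
- by rewrite /row_free mxrank_tr; apply: col_base_full.
- exact: row_base_free.
- by rewrite mulmx_base.
Qed.

End SkewRank.

Section Forms.
Variables (F : fieldType).
Implicit Types A B C D : vectType F.

Local Notation bil A B := {bilinear A -> B -> F | *%R & *%R}.

Definition gram A B (b : bil A B) : 'M[F]_(dim A, dim B) :=
  \matrix_(i, j) b (r2v (delta_mx 0 i)) (r2v (delta_mx 0 j)).

Lemma gramE A B (b : bil A B) x y :
  b x y = (v2r x *m gram b *m (v2r y)^T) 0 0.
Proof.
have H u w : b (r2v u) (r2v w) = \sum_i \sum_j u 0 i * (w 0 j * gram b i j).
  rewrite {1}(row_sum_delta u) linear_sum linear_sumlz; apply: eq_bigr => i _.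
  rewrite {1}(row_sum_delta w) linear_sum linear_sumr; apply: eq_bigr => j _.
  rewrite /= [r2v (u 0 i *: _)]linearZ [r2v (w 0 j *: _)]linearZ /=.
  by rewrite linearZl_LR linearZr_LR mxE.
rewrite -{1}[x]v2rK -{1}[y]v2rK H mxE exchange_big; apply: eq_bigr => j _.
rewrite !mxE mulr_suml; apply: eq_bigr => i _.
by rewrite mulrA mulrAC.
Qed.

Definition nondegl A B (b : bil A B) := forall x, (forall y, b x y = 0) -> x = 0.
Definition nondegr A B (b : bil A B) := forall y, (forall x, b x y = 0) -> y = 0.

Lemma gram_free A B (b : bil A B) : nondegl b -> row_free (gram b).
Proof.
move=> b_nd; apply: inj_row_free => v vb; apply: (can_inj r2vK); rewrite linear0.
by apply: b_nd => y; rewrite gramE r2vK vb mul0mx mxE.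
Qed.

Lemma gram_tr_free A B (b : bil A B) : nondegr b -> row_free (gram b)^T.
Proof.
move=> b_nd; apply: inj_row_free => v vb; apply: (can_inj r2vK); rewrite linear0.
apply: b_nd => x; rewrite gramE r2vK -mulmxA -[gram b]trmxK -trmx_mul vb.
by rewrite trmx0 mulmx0 mxE.
Qed.

Lemma mx_form_inj m n (M N : 'M[F]_(m, n)) :
  (forall (u : 'rV_m) (w : 'rV_n),
     (u *m M *m w^T) 0 0 = (u *m N *m w^T) 0 0) -> M = N.
Proof.
have H (K : 'M[F]_(m, n)) i j :
    ((delta_mx 0 i : 'rV[F]_m) *m K *m (delta_mx 0 j : 'rV[F]_n)^T) 0 0 = K i j.
  by rewrite -rowE trmx_delta -colE !mxE.
by move=> MN; apply/matrixP => i j; rewrite -!H MN.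
Qed.

(** In matrices p G2 = c G1 p'^T, where each Gram matrix can be cancelled by nondegeneracy on the
    appropriate side. *)
Lemma adjoint_rank A A' B B' (b1 : bil A A') (b2 : bil B B')
    (p : 'Hom(A, B)) (p' : 'Hom(B', A')) (c : F) :
  c != 0 -> nondegr b1 -> nondegl b2 ->
  (forall x y, b2 (p x) y = c * b1 x (p' y)) ->
  \dim (limg p) = \dim (limg p').
Proof.
move=> c0 b1_nd b2_nd adj.
have E : f2mx p *m gram b2 = c *: (gram b1 *m (f2mx p')^T).
  apply: mx_form_inj => u w; have := adj (r2v u) (r2v w).
  rewrite !gramE !v2r_lfun !r2vK trmx_mul !mulmxA => ->.
  by rewrite -scalemxAr -scalemxAl [RHS]mxE mulmxA.
rewrite !dim_limg -(mxrankMfree _ (gram_free b2_nd)) E mxrank_scale_nz //.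
by rewrite -mxrank_tr trmx_mul trmxK mxrankMfree //; apply: gram_tr_free.
Qed.

End Forms.

(** * Dual representations and epsilon-forms *)

Section Duality.
Variables (F : fieldType) (n : nat).
Implicit Types (X Y Z : qrep F) (V W : gspace F).

Definition pairing V W := forall i j, {bilinear V i -> W j -> F | *%R & *%R}.

(** [beta] makes W the sigma-twisted dual of V, with arrows adjoint up to sign; an
    epsilon-representation is the self-dual case. Writing [i + j = n.+1] instead of [j = sigma n i]
    avoids casts between the spaces. *)
Definition dual_pair V W (f : repvar V) (g : repvar W) (beta : pairing V W) : Prop :=
  (forall i j, (1 <= i)%N -> (1 <= j)%N -> (i + j = n.+1)%N ->
     nondegl (beta i j) /\ nondegr (beta i j)) /\
  (forall i j, (1 <= i)%N -> (1 <= j)%N -> (i + j = n)%N -> forall x y,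
     beta i.+1 j (f i x) y + beta i j.+1 x (g j y) = 0).

Lemma dual_path V W (f : repvar V) (g : repvar W) (beta : pairing V W) :
  dual_pair f g beta ->
  forall k i j x y, (1 <= i)%N -> (1 <= j)%N -> (i + j + k = n.+1)%N ->
  beta (k + i)%N j (path_map f i k x) y =
    (- 1) ^+ k * beta i (k + j)%N x (path_map g j k y).
Proof.
case=> _ adj; elim=> [|k IH] i j x y i1 j1 ijk.
  by rewrite /= !id_lfunE mul1r.
rewrite (path_map_front _ (fun l z => beta i l x z)) exprS -mulrA -IH; try lia.
rewrite mulN1r; apply/eqP; rewrite -addr_eq0; apply/eqP.
rewrite [path_map _ _ _.+1]/= comp_lfunE; apply: (adj (k + i)%N j); lia.
Qed.

Lemma dual_rk V W (f : repvar V) (g : repvar W) (beta : pairing V W) :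
  dual_pair f g beta ->
  forall i j, (1 <= i)%N -> (i <= j)%N -> (j <= n)%N ->
  rk (QRep f) i j = rk (QRep g) (sigma n j) (sigma n i).
Proof.
move=> bd i j i1 ij jn; rewrite /rk /path_rank /=.
have -> : (sigma n i - sigma n j = j - i)%N by rewrite /sigma; lia.
have [k Ek] : exists k, (k = j - i)%N by exists (j - i)%N.
rewrite -Ek.
have j1 : (1 <= sigma n j)%N by rewrite /sigma; lia.
have ijk : (i + sigma n j + k = n.+1)%N by rewrite /sigma; lia.
apply: (adjoint_rank (b1 := beta i (k + sigma n j)%N)
                     (b2 := beta (k + i)%N (sigma n j)) (c := (-1) ^+ k)).
- by rewrite signr_eq0.
- by have [] := bd.1 i (k + sigma n j)%N i1 ltac:(lia) ltac:(lia).
- by have [] := bd.1 (k + i)%N (sigma n j) ltac:(lia) j1 ltac:(lia).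
- by move=> x y; apply: dual_path.
Qed.

Variable eps : F.

(** Extension by zero: probing the global form with such vectors isolates its blocks. *)
Definition gsingle V i (x : V i) : gvect V := fun k =>
  match @eqP nat i k with ReflectT e => ecast l (V l) e x | _ => 0 end.

Lemma gsingleE V i (x : V i) : gsingle x i = x.
Proof.
by rewrite /gsingle; case: eqP => // e; rewrite (eq_irrelevance e (erefl i)).
Qed.

Lemma gsingle_neq V i k (x : V i) : i != k -> gsingle x k = 0.
Proof. by rewrite /gsingle; case: eqP. Qed.

Lemma form_singlel V (b : gform V) i (x : V i) w : (1 <= i <= n)%N ->
  form_val n b (gsingle x) w = \sum_(1 <= j < n.+1) b i j x (w j).
Proof.
move=> iP; rewrite /form_val (bigD1_seq i) ?iota_uniq ?mem_index_iota //=.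
rewrite [X in _ + X]big1 ?addr0; last first.
  move=> k ki; rewrite big1 // => j _; rewrite gsingle_neq 1?eq_sym //.
  exact: linear0l.
by apply: eq_bigr => j _; rewrite gsingleE.
Qed.

Lemma form_single V (b : gform V) i j (x : V i) (y : V j) :
  (1 <= i <= n)%N -> (1 <= j <= n)%N ->
  form_val n b (gsingle x) (gsingle y) = b i j x y.
Proof.
move=> iP jP; rewrite form_singlel //.
rewrite (bigD1_seq j) ?iota_uniq ?mem_index_iota //=.
rewrite [X in _ + X]big1 ?addr0; last first.
  by move=> k ki; rewrite gsingle_neq 1?eq_sym // linear0r.
by rewrite gsingleE.
Qed.

(** The blockwise form of [compatible_form], in which nondegeneracy is a condition on each
    antidiagonal block. *)
Definition eps_form V (b : gform V) : Prop :=
  [/\ forall i j, (1 <= i)%N -> (1 <= j)%N -> (i + j = n.+1)%N -> nondegl (b i j),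
      forall i j, (1 <= i <= n)%N -> (1 <= j <= n)%N -> forall x y,
        b i j x y = eps * b j i y x
    & forall i j, (1 <= i <= n)%N -> (1 <= j <= n)%N -> (i + j <> n.+1)%N ->
        forall x y, b i j x y = 0].

Lemma compatible_eps_form V (b : gform V) :
  compatible_form n eps b <-> eps_form b.
Proof.
split=> [[nd sym off]|[nd sym off]]; split.
- move=> i j i1 j1 ijn x x0.
  have iP : (1 <= i <= n)%N by lia.
  rewrite -(gsingleE x); apply: nd => // w; rewrite form_singlel // big1_seq // => k /=.
  rewrite mem_index_iota => kP.
  have [kj|kj] : k = j \/ k <> j by lia.
    by move: (w k); rewrite kj.
  by apply: off => //; rewrite /sigma; lia.
- by move=> i j iP jP x y; rewrite -(form_single b) // sym form_single.
- by move=> i j iP jP ijn x y; apply: off => //; rewrite /sigma; lia.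
- move=> v v0 i iP.
  apply: (nd i (sigma n i)); rewrite /sigma; try lia.
  move=> y; rewrite -(v0 (gsingle y)) /form_val.
  rewrite (bigD1_seq i) ?iota_uniq ?mem_index_iota //=.
  have jP : (1 <= n.+1 - i <= n)%N by lia.
  rewrite (bigD1_seq (n.+1 - i)%N) ?iota_uniq ?mem_index_iota //=.
  rewrite gsingleE big1 ?addr0 => [|k kj]; last first.
    by rewrite gsingle_neq 1?eq_sym // linear0r.
  rewrite big1_seq ?addr0 // => k /=; rewrite mem_index_iota => /andP[/eqP ki kP].
  rewrite big1_seq // => l /=; rewrite mem_index_iota => lP.
  have [ll|ll] := eqVneq (n.+1 - i)%N l; last by rewrite gsingle_neq // linear0r.
  by apply: off => //; lia.
- move=> v w; rewrite /form_val exchange_big /= mulr_sumr.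
  apply: eq_big_nat => i iP; rewrite mulr_sumr; apply: eq_big_nat => j jP.
  by apply: sym; lia.
- by move=> i j iP jP ijn x y; apply: off => //; move: ijn; rewrite /sigma; lia.
Qed.


Lemma eps_form_dual V (f : repvar V) (b : gform V) :
  eps_form b -> in_repform n b f ->
  dual_pair f f b.
Proof.
move=> [nd sym off] adj; split=> [i j i1 j1 ijn|i j i1 j1 ijn x y].
  split; first exact: nd.
  move=> y y0; apply: (nd j i) => //; first by rewrite addnC.
  move=> x; rewrite sym; try lia.
  by rewrite y0 mulr0.
have Ej : sigma n i.+1 = j by rewrite /sigma; lia.
by move: y; rewrite -Ej; apply: adj; lia.
Qed.

Lemma dual_in_repform V (f : repvar V) (b : gform V) :
  (forall i j, (1 <= i)%N -> (1 <= j)%N -> (i + j = n)%N -> forall x y,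
     b i.+1 j (f i x) y + b i j.+1 x (f j y) = 0) ->
  in_repform n b f.
Proof. by move=> adj i iP x y; apply: adj; rewrite /sigma; lia. Qed.

Lemma eps_rk_sym X : is_eps_rep n eps X ->
  forall i j, (1 <= i)%N -> (i <= j)%N -> (j <= n)%N ->
  rk X i j = rk X (sigma n j) (sigma n i).
Proof.
case: X => V f [b /compatible_eps_form b_eps fb].
exact: dual_rk (eps_form_dual b_eps fb).
Qed.

(* In the split types the form [(v, w) |-> b (f^k v) w] on [V_i], where [f^k]
   maps [V_i] to [V_(sigma i)], is skew-symmetric, hence of even rank. *)
Lemma eps_rk_even X : 2%:R != 0 :> F ->
  (odd n /\ eps = -1) \/ (~~ odd n /\ eps = 1) -> is_eps_rep n eps X ->
  forall i, (1 <= i)%N -> (i <= sigma n i)%N -> ~~ odd (rk X i (sigma n i)).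
Proof.
move=> F2 split_type; case: X => V f [b /compatible_eps_form b_eps fb] i i1 isi.
have bd := eps_form_dual b_eps fb.
rewrite /rk /path_rank /=; move Ek: (sigma n i - i)%N => k.
have iki : (i + i + k = n.+1)%N by rewrite /sigma in isi Ek *; lia.
have [_ sym _] := b_eps.
have nd : nondegl (b (k + i)%N i).
  by have [] := bd.1 (k + i)%N i ltac:(lia) i1 ltac:(lia).
rewrite dim_limg -(mxrankMfree _ (gram_free nd)).
apply: odd_rank_skew => //; apply: mx_form_inj => u w.
have E u' w' : (u' *m (f2mx (path_map f i k) *m gram (b (k + i)%N i)) *m w'^T) 0 0 =
    b (k + i)%N i (path_map f i k (r2v u')) (r2v w').
  by rewrite gramE v2r_lfun !r2vK mulmxA.
have -> M : (u *m M^T *m w^T) 0 0 = (w *m M *m u^T) 0 0.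
  transitivity ((w *m M *m u^T)^T 0 0); last by rewrite mxE.
  by rewrite !trmx_mul trmxK mulmxA.
rewrite mulmxN mulNmx [RHS]mxE !E.
have := dual_path bd (r2v w) (r2v u) i1 i1 iki; rewrite /= => ->.
rewrite sym; try lia.
rewrite mulrA -[RHS]mulN1r; congr (_ * _).
(* The number k = n + 1 - 2 i has the parity opposite to that of n. *)
rewrite -signr_odd; case: split_type => -[nodd ->].
  by rewrite (_ : odd k = false) ?mul1r //; lia.
by rewrite (_ : odd k = true) ?mulr1 //; lia.
Qed.

End Duality.

(** * Isomorphic representations with forms are isometric *)

Section SquareRoot.
Variable F : closedFieldType.
Hypothesis F2 : 2%:R != 0 :> F.

(* If [p^2 = X] modulo [m], then [p + c m] is a square root of [X] modulo
   [(X - a) m] as soon as [c] is a root of a polynomial of degree 1 or 2. *)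
Lemma poly_sqrt (s : seq F) : 0 \notin s ->
  exists p : {poly F}, \prod_(a <- s) ('X - a%:P) %| p ^+ 2 - 'X.
Proof.
elim: s => [|a s IH]; first by exists 0; rewrite big_nil dvd1p.
rewrite inE negb_or eq_sym => /andP[a0 /IH[p]].
rewrite big_cons; set m := \prod_(_ <- _) _ => /dvdpP[k pk].
(* This is [k + 2 c p + c^2 m] evaluated at a, as a polynomial in c. It is not constant: if m(a) =
   0, then p(a)^2 = a is nonzero. *)
pose q := Poly [:: k.[a]; 2%:R * p.[a]; m.[a]].
have : size q != 1.
  rewrite /q /= !cons_poly_def mul0r add0r.
  have [ma|ma] := eqVneq m.[a] 0.
    have pa : 2%:R * p.[a] != 0.
      rewrite mulf_neq0 //; apply: contraNneq a0 => pa.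
      have := congr1 (horner^~ a) pk; rewrite !hornerE ma pa mulr0 expr0n /= sub0r.
      by move/eqP; rewrite oppr_eq0.
    by rewrite ma mul0r add0r size_MXaddC polyC_eq0 (negbTE pa) size_polyC pa.
  rewrite size_MXaddC size_MXaddC polyC_eq0 (negbTE ma) /= size_polyC ma /=.
  by case: ifP => // /andP[/eqP]; move/(congr1 size);
    rewrite size_MXaddC polyC_eq0 (negbTE ma) size_polyC ma size_poly0.
move=> /closed_rootP[c]; rewrite /root /q /= !cons_poly_def !hornerE /= => /eqP qc.
exists (p + c%:P * m).
have -> : (p + c%:P * m) ^+ 2 - 'X = (k + 2%:R * c%:P * p + c%:P ^+ 2 * m) * m.
  transitivity (p ^+ 2 - 'X + (2%:R * c%:P * p + c%:P ^+ 2 * m) * m); first by ring.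
  by rewrite pk; ring.
rewrite dvdp_mul2r.
  rewrite dvdp_XsubCl /root !hornerE /= -qc; apply/eqP; ring.
by apply: monic_neq0; apply: monic_prod_XsubC.
Qed.

(* [horner_mx] is only available for matrices of positive size. *)
Definition mxhorner n (A : 'M[F]_n) (p : {poly F}) : 'M[F]_n :=
  match n return 'M_n -> 'M_n with
  | 0 => fun=> 0
  | _.+1 => fun A => horner_mx A p
  end A.

Lemma mxhorner_comm m n (A : 'M[F]_m) (A' : 'M[F]_n) (B : 'M_(m, n)) p :
  A *m B = B *m A' -> mxhorner A p *m B = B *m mxhorner A' p.
Proof.
case: m n A A' B => [|m] [|n] A A' B AB; try by rewrite ?thinmx0 ?flatmx0 ?mul0mx ?mulmx0.
rewrite /mxhorner; elim/poly_ind: p => [|p c IH].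
  by rewrite !rmorph0 mul0mx mulmx0.
rewrite !rmorphD !rmorphM /= !horner_mx_X !horner_mx_C mulmxDl mulmxDr.
rewrite mul_scalar_mx mul_mx_scalar -![_ * _]/(_ *m _) -mulmxA AB mulmxA IH.
by rewrite mulmxA.
Qed.

Lemma mxhorner_tr n (A : 'M[F]_n) p : (mxhorner A p)^T = mxhorner A^T p.
Proof.
case: n A => [|n] A; first by rewrite flatmx0 [RHS]flatmx0.
rewrite /mxhorner; elim/poly_ind: p => [|p c IH].
  by rewrite !rmorph0 trmx0.
rewrite !rmorphD !rmorphM /= !horner_mx_X !horner_mx_C linearD /= tr_scalar_mx.
rewrite -![_ * _]/(_ *m _) trmx_mul IH; congr (_ + _).
by rewrite -(@mxhorner_comm n.+1 n.+1 A^T A^T A^T p).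
Qed.

Lemma mxhorner_sqrt n (A : 'M[F]_n) p : char_poly A %| p ^+ 2 - 'X ->
  mxhorner A p *m mxhorner A p = A.
Proof.
case: n A => [|n] A; first by rewrite [LHS]flatmx0 [RHS]flatmx0.
move=> /dvdpP[q Eq]; have := congr1 (horner_mx A) Eq.
rewrite rmorphM /= Cayley_Hamilton mulr0 rmorphB /= rmorphXn /= horner_mx_X.
by move/eqP; rewrite subr_eq0 => /eqP.
Qed.

(** One polynomial serves all vertices, obtained from the product of the characteristic polynomials.
    Only so do the square roots inherit the commutation with the arrows. *)
Lemma common_sqrt n (d : nat -> nat) (A : forall i, 'M[F]_(d i)) :
  (forall i, (1 <= i <= n)%N -> A i \in unitmx) ->
  exists p : {poly F}, forall i, (1 <= i <= n)%N ->
    mxhorner (A i) p *m mxhorner (A i) p = A i.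
Proof.
move=> A_unit; pose m := \prod_(i <- iota 1 n) char_poly (A i).
have [s ms] := closed_field_poly_normal m.
have m_monic : m \is monic by apply: monic_prod => i _; apply: char_poly_monic.
rewrite (monicP m_monic) scale1r in ms.
have [|p mp] := @poly_sqrt s.
  have : ~~ root m 0.
    rewrite /root horner_prod prodf_seq_neq0; apply/allP => i; rewrite mem_iota => iP.
    rewrite horner_coef0 char_poly_det mulf_neq0 ?signr_eq0 //.
    by rewrite -unitfE -unitmxE A_unit //; lia.
  by rewrite ms root_prod_XsubC.
exists p => i iP; apply: mxhorner_sqrt; apply: dvdp_trans mp; rewrite -ms /m.
by rewrite (bigD1_seq i) ?iota_uniq ?mem_iota //= ?dvdp_mulr ?dvdpp //; lia.
Qed.

End SquareRoot.

Section Isometry.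
Variables (F : closedFieldType) (n : nat) (eps : F).
Hypothesis F2 : 2%:R != 0 :> F.

Section Matrices.
Variables (d e : nat -> nat).
Variables (A : forall i, 'M[F]_(d i, d i.+1)) (A' : forall i, 'M[F]_(e i, e i.+1)).
Variables (B : forall i j, 'M[F]_(d i, d j)) (C : forall i j, 'M[F]_(e i, e j)).
Variable (Phi : forall i, 'M[F]_(d i, e i)).
Hypotheses
  (B_free : forall i j, (1 <= i)%N -> (1 <= j)%N -> (i + j = n.+1)%N ->
     row_free (B i j))
  (B_sym : forall i j, (1 <= i)%N -> (1 <= j)%N -> (i + j = n.+1)%N ->
     B i j = eps *: (B j i)^T)
  (B_skew : forall i j, (1 <= i)%N -> (1 <= j)%N -> (i + j = n)%N ->
     A i *m B i.+1 j = - (B i j.+1 *m (A j)^T))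
  (C_free : forall i j, (1 <= i)%N -> (1 <= j)%N -> (i + j = n.+1)%N ->
     row_free (C i j))
  (C_sym : forall i j, (1 <= i)%N -> (1 <= j)%N -> (i + j = n.+1)%N ->
     C i j = eps *: (C j i)^T)
  (C_skew : forall i j, (1 <= i)%N -> (1 <= j)%N -> (i + j = n)%N ->
     A' i *m C i.+1 j = - (C i j.+1 *m (A' j)^T))
  (Phi_free : forall i, (1 <= i <= n)%N -> row_free (Phi i))
  (Phi_full : forall i, (1 <= i <= n)%N -> row_full (Phi i))
  (Phi_comm : forall i, (1 <= i < n)%N -> A i *m Phi i.+1 = Phi i *m A' i).

(* With [Psi = Phi^* Phi] for the adjoint [Phi^*] of [Phi], and [Q] a polynomial
   in [Psi] such that [Q^2 = Psi], the map [Q^-1 Phi] is an isometry. *)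
Lemma mx_isometry : exists Gam : forall i, 'M[F]_(d i, e i),
  [/\ forall i, (1 <= i <= n)%N -> row_free (Gam i) && row_full (Gam i),
      forall i, (1 <= i < n)%N -> A i *m Gam i.+1 = Gam i *m A' i
    & forall i j, (1 <= i)%N -> (1 <= j)%N -> (i + j = n.+1)%N ->
        Gam i *m C i j *m (Gam j)^T = B i j].
Proof.
(* Solves B(x, y Psi) = C(x Phi, y Phi) for the transpose of Psi; matrices act on rows from the
   right. *)
pose PsiT j := pinvmx (B (n.+1 - j)%N j) *m
  (Phi (n.+1 - j)%N *m C (n.+1 - j)%N j *m (Phi j)^T).
have BPsi i j : (1 <= i)%N -> (1 <= j)%N -> (i + j = n.+1)%N ->
    B i j *m PsiT j = Phi i *m C i j *m (Phi j)^T.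
  move=> i1 j1 ijn; have Ei : (n.+1 - j)%N = i by lia.
  by rewrite /PsiT Ei mulmxA mulmxVp ?mul1mx // B_free.
pose Psi j := (PsiT j)^T.
(* Psi is self-adjoint, since both forms have the same symmetry sign. *)
have PsiB i j : (1 <= i)%N -> (1 <= j)%N -> (i + j = n.+1)%N ->
    Psi i *m B i j = Phi i *m C i j *m (Phi j)^T.
  move=> i1 j1 ijn.
  have E : Psi i *m (B j i)^T = Phi i *m (C j i)^T *m (Phi j)^T.
    by rewrite -trmx_mul BPsi ?trmx_mul ?trmxK ?mulmxA //; lia.
  rewrite (B_sym i1 j1 ijn) (C_sym i1 j1 ijn).
  by rewrite -!scalemxAr E -!scalemxAl.
have dE i j : (1 <= i)%N -> (1 <= j)%N -> (i + j = n.+1)%N -> (d i <= d j)%N.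
  move=> i1 j1 ijn; have /eqP <- := B_free i1 j1 ijn; exact: rank_leq_col.
have Psi_unit j : (1 <= j <= n)%N -> Psi j \in unitmx.
  move=> jP; rewrite unitmx_tr -row_full_unit -col_leq_rank.
  pose i := (n.+1 - j)%N; have [i1 j1 ijn] : [/\ 1 <= i, 1 <= j & i + j = n.+1]%N.
    by rewrite /i; split; lia.
  apply: leq_trans (mxrankM_maxr (B i j) (PsiT j)).
  rewrite BPsi // -mulmxA.
  rewrite (_ : \rank _ = d i); first by apply: dE => //; lia.
  have iP : (1 <= i <= n)%N by lia.
  apply/eqP/row_freeP.
  have /row_freeP[P' PP'] := Phi_free iP.
  have /row_freeP[C' CC'] := C_free i1 j1 ijn.
  have /row_fullP[P'' PP''] := Phi_full jP.
  exists (P''^T *m C' *m P').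
  rewrite !mulmxA -[Phi i *m C i j *m _ *m _]mulmxA -trmx_mul PP'' trmx1 mulmx1.
  by rewrite -[Phi i *m _ *m _]mulmxA CC' mulmx1.
(* The arrows are skew-adjoint for both forms, so the same sign appears on both sides. *)
have Psi_comm i : (1 <= i < n)%N -> A i *m Psi i.+1 = Psi i *m A i.
  move=> iP; pose j := (n - i)%N.
  have [i1 j1 ijn] : [/\ 1 <= i, 1 <= j & i + j = n]%N by rewrite /j; split; lia.
  have jP : (1 <= j < n)%N by lia.
  apply: (row_free_inj (B_free (isT : 1 <= i.+1)%N j1 ltac:(lia))).
  rewrite -!mulmxA PsiB ?B_skew //; try lia.
  rewrite !mulmxA Phi_comm // -[Phi i *m _ *m _]mulmxA C_skew //.
  rewrite !(mulmxN, mulNmx); congr (- _).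
  rewrite !mulmxA PsiB //; last by lia.
  rewrite -[LHS]mulmxA -[RHS]mulmxA; congr (_ *m _).
  by rewrite -!trmx_mul Phi_comm.
have [p p_sqr] := common_sqrt F2 Psi_unit.
pose Q i := mxhorner (Psi i) p.
have Q_unit i : (1 <= i <= n)%N -> Q i \in unitmx.
  by move=> iP; have := Psi_unit i iP; rewrite -p_sqr // unitmx_mul => /andP[].
have Q_comm i : (1 <= i < n)%N -> A i *m Q i.+1 = Q i *m A i.
  by move=> iP; apply/esym/mxhorner_comm; rewrite Psi_comm.
have QB i j : (1 <= i)%N -> (1 <= j)%N -> (i + j = n.+1)%N ->
    Q i *m B i j = B i j *m (Q j)^T.
  move=> i1 j1 ijn; rewrite mxhorner_tr; apply: mxhorner_comm.
  by rewrite trmxK PsiB // BPsi.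
exists (fun i => invmx (Q i) *m Phi i); split.
- move=> i iP; apply/andP; split.
    by rewrite /row_free mxrankMfree ?Phi_free // mxrank_unit // unitmx_inv Q_unit.
  rewrite /row_full eqmxMfull; first exact: Phi_full.
  by rewrite row_full_unit unitmx_inv Q_unit.
- move=> i iP; have i1P : (1 <= i.+1 <= n)%N by lia.
  have iP' : (1 <= i <= n)%N by lia.
  have -> : A i *m (invmx (Q i.+1) *m Phi i.+1) = invmx (Q i) *m A i *m Phi i.+1.
    rewrite mulmxA; congr (_ *m _).
    rewrite -[A i in LHS](mulKmx (Q_unit i iP')) -Q_comm // -!mulmxA.
    by rewrite mulmxV ?Q_unit // mulmx1.
  by rewrite -mulmxA Phi_comm // mulmxA.
- move=> i j i1 j1 ijn; have iP : (1 <= i <= n)%N by lia.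
  have jP : (1 <= j <= n)%N by lia.
  have E : Phi i *m C i j *m (Phi j)^T = Q i *m B i j *m (Q j)^T.
    have QQ : Q i *m Q i = Psi i by apply: p_sqr.
    by rewrite -PsiB // -QQ -[LHS]mulmxA [in LHS]QB // mulmxA.
  have -> : invmx (Q i) *m Phi i *m C i j *m (invmx (Q j) *m Phi j)^T =
      invmx (Q i) *m (Phi i *m C i j *m (Phi j)^T) *m (invmx (Q j))^T.
    by rewrite [(_ *m Phi j)^T]trmx_mul !mulmxA.
  rewrite E -[Q i *m _ *m _]mulmxA mulKmx ?Q_unit // -mulmxA -trmx_mul.
  by rewrite mulVmx ?Q_unit // trmx1 mulmx1.
Qed.

End Matrices.
End Isometry.

(** * Degenerations *)

Section Closure.
Variables (F : fieldType) (n : nat) (V : gspace F) (b : gform V).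
Implicit Types (f h : repvar V) (g : forall i, 'End(V i)).

Lemma polyfun_ext p f h : polyfun n p -> (forall i, (1 <= i < n)%N -> f i = h i) ->
  p f = p h.
Proof.
move=> pp fh; elim: pp => //= [i l iP|q r _ -> _ ->|q r _ -> _ ->] //.
by rewrite fh.
Qed.

Lemma polyfun_line f h p : polyfun n p ->
  exists P : {poly F}, forall l, P.[l] = p (fun i => f i + l *: h i).
Proof.
elim=> [a|i s iP|q r _ [Q QE] _ [R RE]|q r _ [Q QE] _ [R RE]].
- by exists a%:P => l; rewrite hornerC.
- exists ((s (f i))%:P + s (h i) *: 'X) => l.
  by rewrite linearD linearZ /= !hornerE mulrC.
- by exists (Q + R) => l; rewrite hornerD QE RE.
- by exists (Q * R) => l; rewrite hornerM QE RE.
Qed.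

Lemma polyfun_base_change p g : polyfun n p -> polyfun n (fun f => p (base_change g f)).
Proof.
elim=> [a|i l iP|q r _ IHq _ IHr|q r _ IHq _ IHr]; first exact: polyfun_cst.
- have l_lin : linear_for *%R
      (fun z : 'Hom(V i, V i.+1) => l (g i.+1 \o z \o (g i)^-1)%VF).
    move=> k u v; rewrite comp_lfunDr comp_lfunDl -comp_lfunZr -comp_lfunZl.
    by rewrite linearP.
  pose L : {linear 'Hom(V i, V i.+1) -> F | *%R} :=
    HB.pack (fun z : 'Hom(V i, V i.+1) => l (g i.+1 \o z \o (g i)^-1)%VF)
      (GRing.isLinear.Build F 'Hom(V i, V i.+1) F *%R _ l_lin).
  exact: (polyfun_lin L iP).
- exact: polyfun_add.
- exact: polyfun_mul.
Qed.

Lemma base_change_comp g g' f i :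
  bijective (g i) -> bijective (g' i) ->
  base_change g' (base_change g f) i = base_change (fun i => g' i \o g i)%VF f i.
Proof.
move=> gi gi'; apply/lfunP => x; rewrite /base_change !comp_lfunE.
have [gK Kg] := lfun_bijK gi; have [gK' Kg'] := lfun_bijK gi'.
rewrite -[x](Kg') -[(g' i)^-1%VF x](Kg); set y := (g i)^-1%VF _.
have cb : bijective (g' i \o g i)%VF.
  by apply: (eq_bij (bij_comp gi' gi)) => z; rewrite comp_lfunE.
have [cK _] := lfun_bijK cb.
rewrite gK' gK; by rewrite -[g' i (g i y)]comp_lfunE cK.
Qed.

(** An orbit closure is stable under the group: a polynomial vanishing on the orbit of f still does
    after pulling back by an isometry, so it vanishes on the whole orbit of f'. *)
Lemma le_deg_trans f f' h : le_deg n b f f' -> le_deg n b f' h -> le_deg n b f h.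
Proof.
move=> ff' f'h p pp p0; apply: f'h => // _ [g [g_bij g_iso] ->].
apply: (ff' _ (polyfun_base_change g pp)) => _ [g' [g'_bij g'_iso] ->].
rewrite (polyfun_ext (h := base_change (fun i => g i \o g' i)%VF f) pp).
  apply: p0; exists (fun i => g i \o g' i)%VF => //; split=> [i iP|v w].
    apply: (eq_bij (bij_comp (g_bij i iP) (g'_bij i iP))) => z.
    by rewrite comp_lfunE.
  rewrite -[RHS]g'_iso -[RHS]g_iso /form_val.
  by apply: eq_bigr => i _; apply: eq_bigr => j _; rewrite !comp_lfunE.
by move=> i iP; apply: base_change_comp; [apply: g'_bij | apply: g_bij]; lia.
Qed.

End Closure.

Section Degeneration.
Variables (F : closedFieldType) (n : nat) (eps : F).
Hypothesis F2 : 2%:R != 0 :> F.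

Section IsometryOfReps.
Variables (V W : gspace F) (b : gform V) (c : gform W).
Variables (f : repvar V) (h : repvar W).
Hypotheses (b_eps : eps_form n eps b) (c_eps : eps_form n eps c).
Hypotheses (f_adj : in_repform n b f) (h_adj : in_repform n c h).

Lemma gram_sym U (a : gform U) : eps_form n eps a ->
  forall i j, (1 <= i)%N -> (1 <= j)%N -> (i + j = n.+1)%N ->
  gram (a i j) = eps *: (gram (a j i))^T.
Proof.
move=> [_ sym _] i j i1 j1 ijn; apply/matrixP => k l; rewrite !mxE.
by apply: sym; lia.
Qed.

Lemma gram_adj U (a : gform U) (r : repvar U) :
  eps_form n eps a -> in_repform n a r ->
  forall i j, (1 <= i)%N -> (1 <= j)%N -> (i + j = n)%N ->
  f2mx (r i) *m gram (a i.+1 j) = - (gram (a i j.+1) *m (f2mx (r j))^T).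
Proof.
move=> a_eps r_adj i j i1 j1 ijn; have [_ adj] := eps_form_dual a_eps r_adj.
apply: mx_form_inj => u w; have /eqP := adj i j i1 j1 ijn (r2v u) (r2v w).
rewrite addr_eq0 => /eqP; rewrite !gramE /= !v2r_lfun !r2vK trmx_mul !mulmxA => ->.
by rewrite mulmxN mulNmx [RHS]mxE !mulmxA.
Qed.

Lemma rep_isometry : qiso n (QRep f) (QRep h) ->
  exists g : forall i, 'Hom(V i, W i),
  [/\ forall i, (1 <= i <= n)%N -> bijective (g i),
      forall i, (1 <= i < n)%N -> forall x, g i.+1 (f i x) = h i (g i x)
    & forall i j, (1 <= i <= n)%N -> (1 <= j <= n)%N -> forall x y,
        c i j (g i x) (g j y) = b i j x y].
Proof.
move=> [phi phi_bij phiE].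
have [|||||||||Gam [Gam_bij Gam_comm GamE]] := @mx_isometry F n eps F2
  (fun i => dim (V i)) (fun i => dim (W i)) (fun i => f2mx (f i)) (fun i => f2mx (h i))
  (fun i j => gram (b i j)) (fun i j => gram (c i j)) (fun i => f2mx (phi i)).
all: try by move=> *; apply: gram_adj.
all: try by move=> *; apply: gram_sym.
- by move=> i j i1 j1 ijn; apply: gram_free; case: b_eps => + _ _; apply.
- by move=> i j i1 j1 ijn; apply: gram_free; case: c_eps => + _ _; apply.
- by move=> i /phi_bij/bij_row_free/andP[].
- by move=> i /phi_bij/bij_row_free/andP[].
- by move=> i iP; rewrite -!f2mx_comp phiE.
exists (fun i => Hom (Gam i)); split.
- by move=> i /Gam_bij/andP[Gfree Gfull]; apply: row_free_bij.
- by move=> i iP x; apply: v2r_inj; rewrite !v2r_lfun /= -!mulmxA Gam_comm.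
- move=> i j iP jP x y; case: b_eps => _ _ b0; case: c_eps => _ _ c0.
  have [ijn|ijn] : (i + j = n.+1)%N \/ (i + j <> n.+1)%N by lia.
    rewrite !gramE !v2r_lfun /= trmx_mul -(GamE i j) ?mulmxA //; lia.
  by rewrite b0 ?c0.
Qed.

End IsometryOfReps.

Variables (V : gspace F) (b : gform V).
Hypothesis b_eps : eps_form n eps b.
Implicit Types (f h : repvar V).

(** The equality is asserted only at the true arrows. [isometry_orbit] asks for it at every index,
    but polynomial functions do not see the others, by [polyfun_ext]. *)
Lemma orbit_of_qiso f h : in_repform n b f -> in_repform n b h ->
  qiso n (QRep f) (QRep h) ->
  exists2 g, isometry_group n b g & forall i, (1 <= i < n)%N -> base_change g f i = h i.
Proof.
move=> f_adj h_adj /(rep_isometry b_eps b_eps f_adj h_adj) [g [g_bij gE g_iso]].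
exists g.
  split=> // v w; rewrite /form_val; apply: eq_big_nat => i iP.
  by apply: eq_big_nat => j jP; apply: g_iso.
move=> i iP; apply/lfunP => x; rewrite /base_change !comp_lfunE gE //.
by have [_ ->] := lfun_bijK (g_bij i ltac:(lia)).
Qed.

Lemma le_deg_qiso f h : in_repform n b f -> in_repform n b h ->
  qiso n (QRep f) (QRep h) -> le_deg n b f h.
Proof.
move=> f_adj h_adj /(orbit_of_qiso f_adj h_adj) [g g_iso gE] p pp p0.
by rewrite -(polyfun_ext pp gE); apply: p0; exists g.
Qed.

(** The family lives on a space of its own. The isometry from V to W given by its member at l = 1
    pulls the whole line back to V, and there every member with l nonzero is in the orbit of f. *)
Lemma degenerate_line (W : gspace F) (c : gform W) (h : F -> repvar W) f :
  eps_form n eps c -> in_repform n b f ->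
  (forall l i, h l i = h 0 i + l *: (h 1 i - h 0 i)) ->
  (forall l, in_repform n c (h l)) ->
  (forall l, l != 0 -> qiso n (QRep f) (QRep (h l))) ->
  exists f', [/\ in_repform n b f', qiso n (QRep f') (QRep (h 0)) & le_deg n b f f'].
Proof.
move=> c_eps f_adj h_line h_adj h_iso.
have [g [g_bij _ g_iso]] :=
  rep_isometry b_eps c_eps f_adj (h_adj 1) (h_iso 1 (oner_neq0 _)).
pose pull (k : repvar W) : repvar V := fun i => ((g i.+1)^-1 \o k i \o g i)%VF.
have pullE (k : repvar W) i x : (1 <= i < n)%N -> g i.+1 (pull k i x) = k i (g i x).
  move=> iP; rewrite !comp_lfunE.
  by have [_ ->] := lfun_bijK (g_bij i.+1 ltac:(lia)).
have pull_iso (k : repvar W) : qiso n (QRep (pull k)) (QRep k).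
  exists g => // i iP; apply/lfunP => x; rewrite comp_lfunE [RHS]comp_lfunE.
  exact: pullE.
have pull_adj (k : repvar W) : in_repform n c k -> in_repform n b (pull k).
  move=> hc; apply: dual_in_repform => i j i1 j1 ijn x y.
  have [_ adj] := eps_form_dual c_eps hc.
  rewrite -!g_iso ?pullE; try lia.
  exact: adj.
exists (pull (h 0)); split; [exact: pull_adj | exact: pull_iso |].
move=> p pp p0.
have [P PE] := polyfun_line (pull (h 0)) (pull (fun i => h 1 i - h 0 i)) pp.
have PE' l : P.[l] = p (pull (h l)).
  rewrite PE; apply: (polyfun_ext pp) => i iP; rewrite /pull [in RHS]h_line.
  by rewrite [in RHS]comp_lfunDr [in RHS]comp_lfunDl -comp_lfunZr -comp_lfunZl.
rewrite -PE'; suff -> : P = 0 by rewrite horner0.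
apply/eqP; apply: contraT => P0.
(* The factor ['X] makes the nonroot nonzero. *)
have /closed_nonrootP[l] : P * 'X != 0 by rewrite mulf_neq0 ?polyX_eq0.
rewrite rootM rootX negb_or => /andP[/eqP Pl l0]; case: Pl; rewrite PE'.
have [|g' g'_iso g'E] := orbit_of_qiso f_adj (pull_adj _ (h_adj l)).
  exact: qiso_trans (h_iso l l0) (qiso_sym (pull_iso _)).
by rewrite -(polyfun_ext pp g'E); apply: p0; exists g'.
Qed.

End Degeneration.

(** * One-parameter families realising cuts and shifts *)

Section Hyperbolic.
Variables (F : fieldType) (n : nat) (eps : F).
Hypothesis eps2 : eps * eps = 1.

Section MkBilinear.
Variables (A B : vectType F) (f : A -> B -> F).
Hypothesis f_bilin : bilinear_for (GRing.Scale.Law.clone _ _ *%R _)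
  (GRing.Scale.Law.clone _ _ *%R _) f.

Fact mkbil_subproof :
  {b : {bilinear A -> B -> F | *%R & *%R} | forall x y, b x y = f x y}.
Proof.
pose fM := bilinear_isBilinear.Build F A B F _ _ f f_bilin.
pose b : {bilinear A -> B -> F | *%R & *%R} := HB.pack f fM.
by exists b.
Qed.

Definition mkbil := sval mkbil_subproof.

Lemma mkbilE x y : mkbil x y = f x y.
Proof. exact: (svalP mkbil_subproof). Qed.

End MkBilinear.

Section HypForm.
Variables (U V W : gspace F) (beta : pairing U V) (c : gform W).

(** The hyperbolic form on U + V given by the pairing, orthogonal to W. The indicator factor
    enforces sigma-compatibility, as [beta] is unconstrained off the antidiagonal. *)
Definition hyp_val i j (u : (U i * V i * W i)%type) (v : (U j * V j * W j)%type) : F :=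
  (i + j == n.+1)%N%:R *
  (beta i j u.1.1 v.1.2 + eps * beta j i v.1.1 u.1.2 + c i j u.2 v.2).

Fact hyp_bilin i j : bilinear_for (GRing.Scale.Law.clone _ _ *%R _)
  (GRing.Scale.Law.clone _ _ *%R _) (@hyp_val i j).
Proof.
split=> [v|u] k x y; rewrite /hyp_val /=.
  by rewrite !linearPl !linearPr /=; ring.
by rewrite !linearPl !linearPr /=; ring.
Qed.

Definition hyp_form : gform (fun i => (U i * V i * W i)%type) :=
  fun i j => mkbil (@hyp_bilin i j).

Lemma hyp_formE i j u v : hyp_form i j u v = (i + j == n.+1)%N%:R *
  (beta i j u.1.1 v.1.2 + eps * beta j i v.1.1 u.1.2 + c i j u.2 v.2).
Proof. exact: mkbilE. Qed.

End HypForm.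

Section HypRep.
Variables (U V W : gspace F) (f : repvar U) (g : repvar V) (h : repvar W).
Variables (beta : pairing U V) (c : gform W).
Hypothesis beta_dual : dual_pair n f g beta.
Hypothesis c_eps : eps_form n eps c.

Lemma hyp_eps_form : eps_form n eps (hyp_form beta c).
Proof.
have [nd sym off] := c_eps.
split=> [i j i1 j1 ijn [[x y] z] h0|i j iP jP u v|i j iP jP /eqP/negbTE ijn u v].
- have E x' y' z' : beta i j x y' + eps * beta j i x' y + c i j z z' = 0.
    by rewrite -[LHS]mul1r -(h0 ((x', y'), z')) hyp_formE /= ijn eqxx.
  have [bl _] := beta_dual.1 i j i1 j1 ijn.
  have [_ br] := beta_dual.1 j i j1 i1 ltac:(lia).
  congr (_, _, _).
  + by apply: bl => y'; have := E 0 y' 0; rewrite linear0l !linear0r mulr0 !addr0.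
  + apply: br => x'; have := E x' 0 0; rewrite !linear0r addr0 add0r.
    by move/(congr1 ( *%R eps)); rewrite mulrA eps2 mul1r mulr0.
  + by apply: (nd i j) => // z'; have := E 0 0 z'; rewrite linear0l !linear0r mulr0 !add0r.
- rewrite !hyp_formE addnC sym //.
  by rewrite !mulrDr !mulrA [eps * _]mulrC -!mulrA [eps * (eps * _)]mulrA eps2; ring.
- by rewrite hyp_formE ijn mul0r.
Qed.

Lemma hyp_in_repform : in_repform n c h ->
  in_repform n (hyp_form beta c) (rsum (rsum f g) h).
Proof.
move=> c_adj; apply: dual_in_repform => i j i1 j1 ijn u v.
have [_ adj] := eps_form_dual c_eps c_adj.
rewrite !hyp_formE !rsumE /= !addSn !addnS ijn eqxx !mul1r.
have /= e1 := adj i j i1 j1 ijn u.2 v.2.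
have e2 := beta_dual.2 i j i1 j1 ijn u.1.1 v.1.2.
have e3 := beta_dual.2 j i j1 i1 ltac:(lia) v.1.1 u.1.2.
transitivity ((beta i.+1 j (f i u.1.1) v.1.2 + beta i j.+1 u.1.1 (g j v.1.2)) +
  eps * (beta j.+1 i (f j v.1.1) u.1.2 + beta j i.+1 v.1.1 (g i u.1.2)) +
  (c i.+1 j (h i u.2) v.2 + c i j.+1 u.2 (h j v.2))); first by ring.
by rewrite e1 e2 e3 mulr0 !addr0.
Qed.

End HypRep.
End Hyperbolic.

Section SegmentForms.
Variables (F : fieldType) (n : nat).

(** The product of two scalars when both spaces are lines; [pid_mx] spares a cast between sizes that
    are only provably equal. *)
Definition bool_form (b c : bool) (x : 'rV[F]_b) (y : 'rV[F]_c) : F :=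
  (x *m pid_mx 1 *m y^T) 0 0.

Lemma bool_form_nondegl (b c : bool) : b = c -> forall x : 'rV[F]_b,
  (forall y : 'rV[F]_c, bool_form x y = 0) -> x = 0.
Proof.
move=> <- x x0; apply/rowP => i; have := x0 (delta_mx 0 i).
by rewrite /bool_form pid_bool_id trmx_delta -colE !mxE.
Qed.

Lemma bool_formC (b c : bool) (x : 'rV[F]_b) (y : 'rV[F]_c) :
  bool_form x y = bool_form y x.
Proof.
rewrite /bool_form; transitivity ((x *m pid_mx 1 *m y^T)^T 0 0).
  by rewrite [RHS]mxE.
by rewrite !trmx_mul trmxK tr_pid_mx mulmxA.
Qed.

Lemma bool_form_pidl (b c d : bool) (x : 'rV[F]_b) (y : 'rV[F]_d) : (b -> d -> c) ->
  bool_form (x *m pid_mx 1 : 'rV_c) y = bool_form x y.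
Proof. by move=> bdc; rewrite /bool_form -[x *m _ *m _]mulmxA pid_bool_comp. Qed.

Lemma bool_form_pidr (b c d : bool) (x : 'rV[F]_b) (y : 'rV[F]_d) : (d -> b -> c) ->
  bool_form x (y *m pid_mx 1 : 'rV_c) = bool_form x y.
Proof. by move=> bdc; rewrite bool_formC bool_form_pidl // bool_formC. Qed.

Lemma bool_formPl (b c : bool) k (x x' : 'rV[F]_b) (y : 'rV[F]_c) :
  bool_form (k *: x + x') y = k * bool_form x y + bool_form x' y.
Proof. by rewrite /bool_form !mulmxDl -!scalemxAl !mxE. Qed.

Lemma bool_formPr (b c : bool) k (x : 'rV[F]_b) (y y' : 'rV[F]_c) :
  bool_form x (k *: y + y') = k * bool_form x y + bool_form x y'.
Proof. by rewrite bool_formC bool_formPl !(bool_formC x). Qed.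

Section SegmentPairing.
Variables (t s : nat).
Local Notation t' := (sigma n s).
Local Notation s' := (sigma n t).

(** The alternating sign turns identity arrows into skew-adjoint ones. *)
Fact seg_bilin i j : bilinear_for (GRing.Scale.Law.clone _ _ *%R _)
  (GRing.Scale.Law.clone _ _ *%R _)
  (fun (x : 'rV[F]_(t <= i <= s)%N) (y : 'rV[F]_(t' <= j <= s')%N) =>
     (-1) ^+ i * bool_form x y).
Proof.
split=> [y|x] k u v /=.
  by rewrite bool_formPl /=; ring.
by rewrite bool_formPr /=; ring.
Qed.

Definition seg_pairing : pairing (qspace (segment F t s)) (qspace (segment F t' s')) :=
  fun i j => mkbil (@seg_bilin i j).

Hypotheses (t1 : (1 <= t)%N) (sn : (s <= n)%N).

Lemma seg_dual :
  dual_pair n (qmap (segment F t s)) (qmap (segment F t' s')) seg_pairing.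
Proof.
split=> [i j i1 j1 ijn|i j i1 j1 ijn x y].
  have bE : (t <= i <= s)%N = (t' <= j <= s')%N by rewrite /sigma; lia.
  split=> [x x0|y y0].
    apply: (bool_form_nondegl bE) => y; have /eqP := x0 y.
    by rewrite mkbilE mulf_eq0 signr_eq0 => /eqP.
  apply: (bool_form_nondegl (esym bE)) => x; have /eqP := y0 x.
  by rewrite mkbilE mulf_eq0 signr_eq0 bool_formC => /eqP.
rewrite !mkbilE !segmentE bool_form_pidl; last by rewrite /sigma; lia.
rewrite bool_form_pidr; last by rewrite /sigma; lia.
by rewrite exprS; ring.
Qed.

End SegmentPairing.

Section ShiftPairing.
Variables (t s q r : nat).
Implicit Types (l : F).

Definition shift_space : gspace F :=
  fun i => ('rV[F]_(t <= i <= s)%N * 'rV[F]_(q <= i <= r)%N)%type.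

(* The segments [t,s] and [q,r] with the arrow into the vertex [q] changed to
   [e |-> l e + f].  For [l != 0] this is U_(t,s) + U_(q,r), for [l = 0] it is
   U_(t,r) + U_(q,s).  When [q = r + 1] the segment [q,r] is empty and the family
   describes a cut. *)
Definition shift_fun l i (u : shift_space i) : shift_space i.+1 :=
  ((if i.+1 == q then l else 1) *: (u.1 *m pid_mx 1),
   (i.+1 == q)%:R *: (u.1 *m pid_mx 1) + u.2 *m pid_mx 1).

(** The adjoint of [shift_fun] on the mirrored segments. The arrow into the old [q] becomes the
    arrow out of its mirror image, which is [r] here, and its matrix is transposed. *)
Definition coshift_fun l i (u : shift_space i) : shift_space i.+1 :=
  ((if i == r then l else 1) *: (u.1 *m pid_mx 1) + (i == r)%:R *: (u.2 *m pid_mx 1),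
   u.2 *m pid_mx 1).

Fact shift_lin l i : linear (@shift_fun l i).
Proof.
move=> k u v; rewrite /shift_fun /=; congr (_, _) => /=; rewrite !mulmxDl -!scalemxAl.
  by rewrite !scalerDr !scalerA mulrC.
by rewrite !scalerDr !scalerA mulrC addrACA.
Qed.

Fact coshift_lin l i : linear (@coshift_fun l i).
Proof.
move=> k u v; rewrite /coshift_fun /=; congr (_, _) => /=; rewrite !mulmxDl -!scalemxAl //.
by rewrite !scalerDr !scalerA addrACA mulrC [(i == r)%:R * k]mulrC.
Qed.

Definition shift_map l : repvar shift_space := fun i => mklfun (@shift_lin l i).
Definition coshift_map l : repvar shift_space := fun i => mklfun (@coshift_lin l i).

Lemma shift_line l i x : shift_map l i x = shift_map 0 i x +
  l *: (shift_map 1 i x - shift_map 0 i x).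
Proof.
rewrite !mklfunE /shift_fun /=; congr (_, _) => /=; last by rewrite subrr scaler0 addr0.
by case: eqP; rewrite ?scale0r ?scale1r ?subr0 ?add0r // subrr scaler0 addr0.
Qed.

Lemma coshift_line l i x : coshift_map l i x = coshift_map 0 i x +
  l *: (coshift_map 1 i x - coshift_map 0 i x).
Proof.
rewrite !mklfunE /coshift_fun /=; congr (_, _) => /=; last by rewrite subrr scaler0 addr0.
case: eqP => _; rewrite ?scale0r ?scale1r ?add0r; last by rewrite subrr scaler0 !addr0.
by rewrite addrK addrC.
Qed.

End ShiftPairing.

Section ShiftDual.
Variables (t s q r : nat).
Local Notation t' := (sigma n s).
Local Notation s' := (sigma n t).
Local Notation q' := (sigma n r).
Local Notation r' := (sigma n q).

Fact shift_bilin i j : bilinear_for (GRing.Scale.Law.clone _ _ *%R _)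
  (GRing.Scale.Law.clone _ _ *%R _)
  (fun (x : shift_space t s q r i) (y : shift_space t' s' q' r' j) =>
     (-1) ^+ i * (bool_form x.1 y.1 + bool_form x.2 y.2)).
Proof.
split=> [y|x] k u v /=.
  by rewrite !bool_formPl /=; ring.
by rewrite !bool_formPr /=; ring.
Qed.

Definition shift_pairing :
    pairing (shift_space t s q r) (shift_space t' s' q' r') :=
  fun i j => mkbil (@shift_bilin i j).

Hypotheses (t1 : (1 <= t)%N) (tq : (t < q)%N) (qr : (q <= r.+1)%N)
  (rs : (r < s)%N) (sn : (s <= n)%N).

Lemma shift_dual l :
  dual_pair n (shift_map t s q r l) (coshift_map t' s' q' r' l) shift_pairing.
Proof.
split=> [i j i1 j1 ijn|i j i1 j1 ijn [x1 x2] [y1 y2]].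
  have bE : (t <= i <= s)%N = (t' <= j <= s')%N by rewrite /sigma; lia.
  have bE' : (q <= i <= r)%N = (q' <= j <= r')%N by rewrite /sigma; lia.
  have f0 (b c : bool) (x : 'rV[F]_b) : bool_form x (0 : 'rV_c) = 0.
    by rewrite /bool_form trmx0 mulmx0 mxE.
  have f0' (b c : bool) (x : 'rV[F]_b) : bool_form (0 : 'rV_c) x = 0.
    by rewrite bool_formC.
  split=> [[x1 x2] x0|[y1 y2] y0]; congr (_, _).
  - apply: (bool_form_nondegl bE) => y; have /eqP := x0 (y, 0).
    by rewrite mkbilE mulf_eq0 signr_eq0 f0 addr0 => /eqP.
  - apply: (bool_form_nondegl bE') => y; have /eqP := x0 (0, y).
    by rewrite mkbilE mulf_eq0 signr_eq0 f0 add0r => /eqP.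
  - apply: (bool_form_nondegl (esym bE)) => x; have /eqP := y0 (x, 0).
    by rewrite mkbilE mulf_eq0 signr_eq0 f0' addr0 bool_formC => /eqP.
  - apply: (bool_form_nondegl (esym bE')) => x; have /eqP := y0 (0, x).
    by rewrite mkbilE mulf_eq0 signr_eq0 f0' add0r bool_formC => /eqP.
rewrite !mkbilE !mklfunE /shift_fun /coshift_fun /=.
have -> : (j == r') = (i.+1 == q) by rewrite /sigma; apply/eqP/eqP; lia.
rewrite !bool_formPl !bool_formPr.
have fZ (b c : bool) k (x : 'rV[F]_b) (y : 'rV[F]_c) :
    bool_form (k *: x) y = k * bool_form x y.
  by rewrite /bool_form -!scalemxAl mxE.
have fZ' (b c : bool) k (x : 'rV[F]_b) (y : 'rV[F]_c) :
    bool_form x (k *: y) = k * bool_form x y.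
  by rewrite bool_formC fZ bool_formC.
rewrite !fZ ?fZ' exprS.
rewrite (bool_form_pidl x1 y1); last by rewrite /sigma; lia.
rewrite (bool_form_pidl x2 y2); last by rewrite /sigma; lia.
rewrite (bool_form_pidr x1 y1); last by rewrite /sigma; lia.
rewrite (bool_form_pidr x2 y2); last by rewrite /sigma; lia.
have [iq|_] := eqVneq i.+1 q; last by rewrite !mul0r; ring.
rewrite (bool_form_pidl x1 y2); last by rewrite /sigma; lia.
rewrite (bool_form_pidr x1 y2); last by rewrite /sigma; lia.
by ring.
Qed.

End ShiftDual.
End SegmentForms.

Section ShiftIso.
Variables (F : fieldType) (n t s q r : nat).
Hypotheses (t1 : (1 <= t)%N) (tq : (t < q)%N) (qr : (q <= r.+1)%N)
  (rs : (r < s)%N) (sn : (s <= n)%N).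

Lemma rV_bool0 (b : bool) (x : 'rV[F]_b) : ~~ b -> x = 0.
Proof. by case: b x => // x _; apply: thinmx0. Qed.

Lemma mul_pid_bool (a b c : bool) (x : 'rV[F]_a) : (a -> c -> b) ->
  x *m (pid_mx 1 : 'M_(a, b)) *m (pid_mx 1 : 'M_(b, c)) = x *m pid_mx 1.
Proof. by move=> abc; rewrite -mulmxA pid_bool_comp. Qed.

Lemma mul_pid_bool_id (a b : bool) (x : 'rV[F]_a) : (a -> b) ->
  x *m (pid_mx 1 : 'M_(a, b)) *m (pid_mx 1 : 'M_(b, a)) = x.
Proof. by move=> ab; rewrite mul_pid_bool ?pid_bool_id // => /ab. Qed.

(** Used with the inverse of the parameter of the family: from q on these are coordinates in the
    basis (l e + f, f), as a e + b f = (a / l) (l e + f) + (b - a / l) f. *)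
Definition generic_fun (l : F) i (u : shift_space F t s q r i) :
    ('rV[F]_(t <= i <= s)%N * 'rV[F]_(q <= i <= r)%N)%type :=
  ((if (i < q)%N then 1 else l) *: u.1,
   u.2 - (if (i < q)%N then 0 else l) *: (u.1 *m pid_mx 1)).

Fact generic_lin l i : linear (@generic_fun l i).
Proof.
move=> k u v; rewrite /generic_fun /=; congr (_, _) => /=.
  by rewrite scalerDr !scalerA mulrC.
by rewrite mulmxDl -scalemxAl scalerDr opprD addrACA scalerBr !scalerA mulrC.
Qed.

Lemma shift_generic l : l != 0 ->
  qiso n (QRep (shift_map t s q r l)) (qsum (segment F t s) (segment F q r)).
Proof.
move=> l0; exists (fun i => mklfun (@generic_lin l^-1 i)) => i iP.
  exists (fun v : shift_space F t s q r i => ((if (i < q)%N then 1 else l) *: v.1,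
     v.2 + (if (i < q)%N then 0 else 1) *: (v.1 *m pid_mx 1))) => [[x y]|[x y]].
    rewrite mklfunE /generic_fun /=; case: ifP => _.
      by rewrite !scale1r !scale0r addr0 subr0.
    by rewrite scalerA divff // !scale1r -scalemxAl subrK.
  rewrite mklfunE /generic_fun /=; case: ifP => _.
    by rewrite !scale1r !scale0r addr0 subr0.
  by rewrite !scalerA mulVf // !scale1r -!scalemxAl scalerA mulVf // scale1r addrK.
apply/lfunP => -[x y]; rewrite !comp_lfunE qsumE !mklfunE /shift_fun /generic_fun /=.
rewrite !segmentE /=; have [iq|iq] : (i.+1 < q)%N \/ (q <= i.+1)%N by lia.
  have -> : (i.+1 < q)%N = true by lia.
  have -> : (i < q)%N = true by lia.
  have -> : (i.+1 == q) = false by lia.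
  by rewrite !scale1r !scale0r !subr0 add0r.
have -> : (i.+1 < q)%N = false by lia.
have [eiq|niq] := eqVneq i.+1 q.
  have -> : (i < q)%N by lia.
  rewrite !scale1r scale0r subr0 scalerA mulVf // scale1r.
  rewrite -scalemxAl scalerA mulVf // scale1r.
  by rewrite mul_pid_bool ?addKr ?[_ + y *m _]addrC ?addrK //; lia.
have -> : (i < q)%N = false by lia.
rewrite scale0r scale1r add0r -scalemxAl mulmxBl -scalemxAl; congr (_, _ - _ *: _).
by rewrite !mul_pid_bool //; lia.
Qed.

(** At l = 0 the arrow into q maps e to f. So the chain from t continues in the second summand up to
    r, a new chain starts in the first at q, and the summands swap. *)
Definition special_fun i (u : shift_space F t s q r i) :
    ('rV[F]_(t <= i <= r)%N * 'rV[F]_(q <= i <= s)%N)%type :=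
  if (i < q)%N then (u.1 *m pid_mx 1, u.2 *m pid_mx 1)
  else (u.2 *m pid_mx 1, u.1 *m pid_mx 1).

Fact special_lin i : linear (@special_fun i).
Proof.
by move=> k u v; rewrite /special_fun; case: ifP => _; congr (_, _) => /=;
  rewrite mulmxDl -scalemxAl.
Qed.

Lemma shift_special :
  qiso n (QRep (shift_map t s q r (0 : F))) (qsum (segment F t r) (segment F q s)).
Proof.
exists (fun i => mklfun (@special_lin i)) => i iP.
  exists (fun v : ('rV[F]_(t <= i <= r)%N * 'rV[F]_(q <= i <= s)%N)%type =>
     if (i < q)%N then (v.1 *m pid_mx 1, v.2 *m pid_mx 1) : shift_space F t s q r i
     else (v.2 *m pid_mx 1, v.1 *m pid_mx 1)) => [[x y]|[x y]].
    rewrite mklfunE /special_fun /=.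
    have [iq|iq] : (i < q)%N = true \/ (i < q)%N = false by lia.
      rewrite iq /= mul_pid_bool_id; last lia; congr (_, _).
      by rewrite (@rV_bool0 (q <= i <= r)%N y) ?mul0mx //; lia.
    by rewrite iq /= !mul_pid_bool_id //; lia.
  rewrite mklfunE /special_fun /=.
  have [iq|iq] : (i < q)%N = true \/ (i < q)%N = false by lia.
    rewrite iq /= mul_pid_bool_id; last lia; congr (_, _).
    by rewrite (@rV_bool0 (q <= i <= s)%N y) ?mul0mx //; lia.
  by rewrite iq /= !mul_pid_bool_id //; lia.
apply/lfunP => -[x y]; rewrite !comp_lfunE qsumE !mklfunE /shift_fun /special_fun /=.
rewrite !segmentE /=; have [iq|iq] : (i.+1 < q)%N \/ (q <= i.+1)%N by lia.
  have -> : (i.+1 < q)%N = true by lia.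
  have -> : (i < q)%N = true by lia.
  have -> : (i.+1 == q) = false by lia.
  rewrite scale1r scale0r add0r /= !mul_pid_bool //; lia.
have -> : (i.+1 < q)%N = false by lia.
have [eiq|niq] := eqVneq i.+1 q.
  have -> : (i < q)%N = true by lia.
  rewrite /= scale0r scale1r !mul0mx (@rV_bool0 (q <= i <= r)%N y); last by lia.
  by rewrite !mul0mx addr0 !mul_pid_bool //; lia.
have -> : (i < q)%N = false by lia.
by rewrite /= scale1r scale0r add0r !mul_pid_bool //; lia.
Qed.

End ShiftIso.

(** * Cuts and shifts are degenerations *)

Section Steps.
Variables (F : closedFieldType) (n : nat) (eps : F).
Hypotheses (F2 : 2%:R != 0 :> F) (eps2 : eps * eps = 1).

Variables (V : gspace F) (b : gform V).
Hypothesis b_eps : eps_form n eps b.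

Lemma shift_le_deg (f : repvar V) (Z : qrep F) t q r s : in_repform n b f ->
  is_eps_rep n eps Z ->
  (1 <= t)%N -> (t < q)%N -> (q <= r.+1)%N -> (r < s)%N -> (s <= n)%N ->
  (forall i j, (1 <= i)%N -> (i <= j)%N -> (j <= n)%N ->
     rk (QRep f) i j = (sym_rk n (t, s) i j + sym_rk n (q, r) i j + rk Z i j)%N) ->
  exists f', [/\ in_repform n b f', le_deg n b f f'
    & forall i j, (1 <= i)%N -> (i <= j)%N -> (j <= n)%N ->
     rk (QRep f') i j = (sym_rk n (t, r) i j + sym_rk n (q, s) i j + rk Z i j)%N].
Proof.
case: Z => W z f_adj [c /compatible_eps_form /= c_eps c_adj] t1 tq qr rs sn f_rk.
pose X (l : F) := shift_map t s q r l.
pose Y (l : F) := coshift_map (sigma n s) (sigma n t) (sigma n r) (sigma n q) l.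
have XY l : dual_pair n (X l) (Y l) (shift_pairing F n t s q r) by apply: shift_dual.
(* The mirrored half gets its ranks by duality, so only [X l] has to be identified. *)
have rkY l i j : (1 <= i)%N -> (i <= j)%N -> (j <= n)%N ->
    rk (QRep (Y l)) i j = rk (QRep (X l)) (sigma n j) (sigma n i).
  move=> i1 ij jn; rewrite (dual_rk (XY l)) /sigma; try lia.
  by congr (rk _ _ _); lia.
pose h l := rsum (rsum (X l) (Y l)) z.
have rkh l A B : qiso n (QRep (X l)) (qsum (segment F A.1 A.2) (segment F B.1 B.2)) ->
    (maxn A.1 A.2 <= n)%N -> (maxn B.1 B.2 <= n)%N ->
    forall i j, (1 <= i)%N -> (i <= j)%N -> (j <= n)%N ->
    rk (QRep (h l)) i j = (sym_rk n A i j + sym_rk n B i j + rk (QRep z) i j)%N.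
  move=> XAB; rewrite !geq_max => /andP[A1 A2] /andP[B1 B2] i j i1 ij jn.
  have -> : rk (QRep (h l)) i j =
      (rk (QRep (X l)) i j + rk (QRep (Y l)) i j + rk (QRep z) i j)%N.
    by rewrite -!rk_sum.
  rewrite rkY // !(qiso_rk XAB) ?rk_sum /sigma; try lia.
  rewrite !rk_segment -/(sigma n _) -/(sigma n _) /sigma; try lia.
  rewrite -!/(sigma n _) !seg_rk_sigma; try lia.
  by rewrite /sym_rk; lia.
have h_line l i : h l i = h 0 i + l *: (h 1 i - h 0 i).
  apply/lfunP => -[[x y] w].
  rewrite add_lfunE scale_lfunE add_lfunE opp_lfunE /h !rsumE /=.
  rewrite [in LHS]/X [in LHS]/Y shift_line coshift_line.
  by congr (_, _, _) => /=; rewrite subrr scaler0 addr0.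
have h_adj l : in_repform n (hyp_form n eps (shift_pairing F n t s q r) c) (h l).
  exact: hyp_in_repform (XY l) c_eps c_adj.
have h_iso l : l != 0 -> qiso n (QRep f) (QRep (h l)).
  move=> l0; apply: qiso_of_rk => i j i1 ij jn; rewrite f_rk //.
  by rewrite (@rkh l (t, s) (q, r)) //=; [apply: shift_generic | lia | lia].
have [f' [f'_adj f'_iso f'_deg]] :=
  degenerate_line F2 b_eps (hyp_eps_form eps2 (XY 0) c_eps) f_adj h_line h_adj h_iso.
exists f'; split=> // i j i1 ij jn; rewrite (qiso_rk f'_iso) //.
by rewrite (@rkh 0 (t, r) (q, s)) //=; [apply: shift_special | lia | lia].
Qed.

(** The intermediate representations of a sequence of moves live on arbitrary spaces. Quantifying
    over points of V isomorphic to the two ends allows each of them to be realised anew on V with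
    its form. *)
Lemma le_c_le_deg X Y : le_c n eps X Y -> forall f h : repvar V,
  in_repform n b f -> in_repform n b h ->
  qiso n (QRep f) X -> qiso n (QRep h) Y -> le_deg n b f h.
Proof.
elim=> {X Y} [X Y XY|X Y X' [t [q [s [Z [[t1 tq qs sn] Z_eps XE YE]]]]] _ IH
  |X Y X' [t [q [r [s [Z [[t1 tq qr rs sn] Z_eps XE YE]]]]]] _ IH]
  f h f_adj h_adj fX hY.
- apply: (le_deg_qiso F2 b_eps) => //.
  exact: qiso_trans fX (qiso_trans XY (qiso_sym hY)).
(* A cut at q is the shift with the empty inner segment [q + 1, q]. *)
- have [|||||f' [f'_adj ff' f'_rk]] :=
    @shift_le_deg f Z t q.+1 q s f_adj Z_eps t1; try lia.
    move=> i j i1 ij jn; rewrite (qiso_rk (qiso_trans fX XE)) // !rk_sum !rk_segment //.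
    by rewrite ?sym_rk_empty /sym_rk /=; lia.
  apply: (le_deg_trans ff'); apply: IH => //; apply: qiso_of_rk => i j i1 ij jn.
  rewrite f'_rk // (qiso_rk YE) // !rk_sum !rk_segment //.
  by rewrite ?sym_rk_empty /sym_rk /=; lia.
- have [|||||f' [f'_adj ff' f'_rk]] :=
    @shift_le_deg f Z t q r s f_adj Z_eps t1; try lia.
    move=> i j i1 ij jn; rewrite (qiso_rk (qiso_trans fX XE)) // !rk_sum !rk_segment //.
    by rewrite /sym_rk /=; lia.
  apply: (le_deg_trans ff'); apply: IH => //; apply: qiso_of_rk => i j i1 ij jn.
  rewrite f'_rk // (qiso_rk YE) // !rk_sum !rk_segment //.
  by rewrite /sym_rk /=; lia.
Qed.

End Steps.

(** * Semicontinuity of ranks *)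

Section Semicontinuity.
Variables (F : fieldType) (n : nat) (V : gspace F).
Implicit Types (f : repvar V) (p q : repvar V -> F).

Lemma eq_polyfun p q : p =1 q -> polyfun n p -> polyfun n q.
Proof. by move=> /boolp.funext ->. Qed.

Lemma polyfun_sum I (r : seq I) (G : I -> repvar V -> F) :
  (forall i, polyfun n (G i)) -> polyfun n (fun f => \sum_(i <- r) G i f).
Proof.
move=> GP; elim: r => [|i r IH].
  by apply: (eq_polyfun (p := fun=> 0)); [move=> f; rewrite big_nil | exact: polyfun_cst].
apply: (eq_polyfun (p := fun f => G i f + \sum_(j <- r) G j f)).
  by move=> f; rewrite big_cons.
exact: polyfun_add.
Qed.

Lemma polyfun_prod I (r : seq I) (G : I -> repvar V -> F) :
  (forall i, polyfun n (G i)) -> polyfun n (fun f => \prod_(i <- r) G i f).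
Proof.
move=> GP; elim: r => [|i r IH].
  by apply: (eq_polyfun (p := fun=> 1)); [move=> f; rewrite big_nil | exact: polyfun_cst].
apply: (eq_polyfun (p := fun f => G i f * \prod_(j <- r) G j f)).
  by move=> f; rewrite big_cons.
exact: polyfun_mul.
Qed.

Definition polymx k l (A : repvar V -> 'M[F]_(k, l)) :=
  forall x y, polyfun n (fun f => A f x y).

Lemma polymx_mul k l m (A : repvar V -> 'M[F]_(k, l)) (B : repvar V -> 'M[F]_(l, m)) :
  polymx A -> polymx B -> polymx (fun f => A f *m B f).
Proof.
move=> AP BP x y; apply: (eq_polyfun (p := fun f => \sum_z A f x z * B f z y)).
  by move=> f; rewrite mxE.
by apply: polyfun_sum => z; apply: polyfun_mul.
Qed.

Lemma polyfun_det k (A : repvar V -> 'M[F]_k) :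
  polymx A -> polyfun n (fun f => \det (A f)).
Proof.
move=> AP; apply: polyfun_sum => s; apply: polyfun_mul; first exact: polyfun_cst.
by apply: polyfun_prod.
Qed.

Lemma f2mx_linear (A B : vectType F) x y :
  linear_for *%R (fun f : 'Hom(A, B) => f2mx f x y).
Proof.
move=> k f g; rewrite (_ : f2mx _ = k *: f2mx f + f2mx g) ?mxE //.
by apply: f2mx_eq => u; rewrite add_lfunE scale_lfunE linearP /= !v2r_lfun
  mulmxDr scalemxAr.
Qed.

Lemma polymx_path i k : (1 <= i)%N -> (k + i <= n)%N ->
  polymx (fun f => f2mx (path_map f i k)).
Proof.
move=> i1; elim: k => [|k IH] kin.
  by move=> x y; apply: polyfun_cst.
move=> x y; apply: (eq_polyfun
   (p := fun f => (f2mx (path_map f i k) *m f2mx (f (k + i)%N)) x y)).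
  by move=> f; rewrite -f2mx_comp.
apply: polymx_mul; first by apply: IH; lia.
move=> {}x {}y.
pose L : {linear 'Hom(V (k + i)%N, V (k + i).+1) -> F | *%R} :=
  HB.pack (fun z : 'Hom(V (k + i)%N, V (k + i).+1) => f2mx z x y)
    (GRing.isLinear.Build F _ F *%R _ (f2mx_linear x y)).
by apply: (polyfun_lin L); lia.
Qed.

Lemma orbit_rk (b : gform V) f h : isometry_orbit n b f h ->
  qiso n (QRep f) (QRep h).
Proof.
move=> [g [g_bij _] ->]; exists g => //= i iP.
apply/lfunP => x; rewrite /base_change !comp_lfunE.
by have [-> _] := lfun_bijK (g_bij i ltac:(lia)).
Qed.

Lemma le_deg_rk (b : gform V) M N i j : le_deg n b M N ->
  (1 <= i)%N -> (i <= j)%N -> (j <= n)%N -> (path_rank N i j <= path_rank M i j)%N.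
Proof.
move=> MN i1 ij jn; rewrite leqNgt; apply/negP => rMN.
pose A f := f2mx (path_map f i (j - i)); pose r := \rank (A N).
(* P and Q reduce the matrix of N to the identity of size r. On the orbit of M the rank is below r,
   so this one determinant vanishes there. *)
pose P : 'M_(r, _) := pid_mx r *m invmx (col_ebase (A N)).
pose Q : 'M_(_, r) := invmx (row_ebase (A N)) *m pid_mx r.
have det_poly : polyfun n (fun f => \det (P *m A f *m Q)).
  apply: polyfun_det; apply: polymx_mul; last by move=> x y; apply: polyfun_cst.
  apply: polymx_mul; first by move=> x y; apply: polyfun_cst.
  by apply: polymx_path; lia.
have := MN _ det_poly; rewrite /= => H.
have : \det (P *m A N *m Q) = 1.
  rewrite -[A N]mulmx_ebase /P /Q !mulmxA mulmxKV ?col_ebase_unit //.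
  rewrite mulmxK ?row_ebase_unit // !mul_pid_mx.
  rewrite (_ : minn _ _ = r) ?pid_mx_1 ?det1 // /r.
  by have := rank_leq_row (A N); have := rank_leq_col (A N); lia.
rewrite H; first by move/eqP; rewrite eq_sym oner_eq0.
move=> h /orbit_rk hM; apply/eqP; apply: contraT => /negP d0.
have /mxrank_unit rk_r : P *m A h *m Q \in unitmx.
  by rewrite unitmxE unitfE; apply/negP.
have : (r <= \rank (A h))%N.
  by rewrite -rk_r; apply: leq_trans (mxrankM_maxl _ _) (mxrankM_maxr _ _).
have := qiso_rk hM i1 ij jn; rewrite /rk /path_rank /= in rMN *.
by rewrite !dim_limg in rMN *; rewrite /r /A; lia.
Qed.

End Semicontinuity.

(** * Combinatorics of symmetric multisegments *)

Section Combinatorics.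
Local Open Scope nat_scope.
Variable n : nat.
Implicit Types (p : nat * nat) (L S T : seq (nat * nat)).

Definition seg_valid p := [&& 1 <= p.1, p.1 <= p.2 & p.2 <= n].
Definition mirror p := (sigma n p.2, sigma n p.1).
Definition mrk L i j := count (fun p => (p.1 <= i) && (j <= p.2)) L.
(** [S] holds one representative of each symmetric segment; a segment equal to its mirror image is
    counted twice. *)
Definition symmetrize S := S ++ map mirror S.
Definition srk S := mrk (symmetrize S).

(** Inclusion-exclusion: the segments starting in (i, k] and ending in [j, l) are counted by a
    second difference of ranks. *)
Lemma mrk_box L i k j l : i <= k -> j <= l ->
  count (fun p => (i < p.1 <= k) && (j <= p.2 < l)) L + mrk L i j + mrk L k l =
  mrk L k j + mrk L i l.
Proof.
rewrite /mrk => ik jl; elim: L => //= -[x y] L IH /=.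
suff : ((i < x <= k) && (j <= y < l)) + ((x <= i) && (j <= y)) + ((x <= k) && (l <= y))
  = ((x <= k) && (j <= y)) + ((x <= i) && (l <= y)) :> nat by lia.
clear IH; lia.
Qed.

Lemma mrk_cell L i j : 
  count_mem (i.+1, j) L + mrk L i j + mrk L i.+1 j.+1 = mrk L i.+1 j + mrk L i j.+1.
Proof.
rewrite -mrk_box //; congr (_ + _ + _); apply: eq_count => -[x y] /=.
by rewrite xpair_eqE; lia.
Qed.

Lemma mrk_out L i j : all seg_valid L -> (i == 0) || (n < j) -> mrk L i j = 0.
Proof.
move=> /allP Lv ij; apply/eqP; rewrite -leqn0 leqNgt -has_count.
apply/hasPn => -[x y] /Lv.
by rewrite /seg_valid /=; lia.
Qed.

Lemma mirrorK p : seg_valid p -> mirror (mirror p) = p.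
Proof.
by case: p => x y; rewrite /seg_valid /mirror /sigma /= => v; congr (_, _); lia.
Qed.

Lemma mirror_valid p : seg_valid p -> seg_valid (mirror p).
Proof. by case: p => x y; rewrite /seg_valid /mirror /sigma /=; lia. Qed.

Lemma symmetrize_valid S : all seg_valid S -> all seg_valid (symmetrize S).
Proof.
move=> Sv; rewrite all_cat Sv all_map /=; apply: sub_all Sv; exact: mirror_valid.
Qed.

Lemma srk_cons p S i j : srk (p :: S) i j = sym_rk n p i j + srk S i j.
Proof. by rewrite /srk /mrk !count_cat /= /sym_rk /seg_rk; lia. Qed.

Lemma srk_mirror S i j : all seg_valid S -> i <= n -> j <= n ->
  srk S (sigma n j) (sigma n i) = srk S i j.
Proof.
move=> Sv iN jN; elim: S Sv => //= -[x y] S IH /andP[pv /IH Sv]; rewrite !srk_cons Sv.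
congr (_ + _); move: pv; rewrite /seg_valid /sym_rk /= => pv.
rewrite seg_rk_sigma; try lia.
have -> : seg_rk x y i j = seg_rk (sigma n (sigma n x)) (sigma n (sigma n y)) i j.
  by congr seg_rk; rewrite /sigma; lia.
rewrite -[in RHS]seg_rk_sigma /sigma; try lia.
Qed.

(** On the axis of symmetry a segment and its mirror image contribute equally. *)
Lemma srk_even S i : all seg_valid S -> i <= n -> 1 <= i -> ~~ odd (srk S i (sigma n i)).
Proof.
move=> Sv iN i1; elim: S Sv => //= -[x y] S IH /andP[pv /IH Sv]; rewrite srk_cons.
rewrite oddD (negbTE Sv) addbF; move: pv; rewrite /seg_valid /sym_rk /= => pv.
rewrite -seg_rk_sigma; try (rewrite /sigma; lia).
rewrite (_ : sigma n (sigma n i) = i); last by rewrite /sigma; lia.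
by rewrite addnn odd_double.
Qed.

(** The list may contain p only through its mirror image. The last clause records what remains
    available, so that a second segment can be extracted. *)
Lemma symmetrize_extract S p : all seg_valid S -> p \in symmetrize S ->
  exists S', [/\ all seg_valid S',
    forall i j, srk S i j = sym_rk n p i j + srk S' i j
    & forall x, x \in symmetrize S -> [\/ x \in symmetrize S', x = p | x = mirror p]].
Proof.
move=> Sv pS; have [p' [p'S p'E p'M]] : exists p', [/\ p' \in S,
    forall i j, sym_rk n p' i j = sym_rk n p i j & (p' = p /\ mirror p' = mirror p) \/
      (p' = mirror p /\ mirror p' = p)].
  move: pS; rewrite mem_cat => /orP[pS|/mapP[p' p'S ->]].
    by exists p; split=> //; left.
  have p'v := allP Sv p' p'S.
  exists p'; split=> // [i j|]; last by right; rewrite mirrorK.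
  rewrite /sym_rk addnC; have := mirrorK p'v; case: (p') => x y /= [-> ->].
  by [].
have perm := perm_to_rem p'S.
exists (rem p' S); split.
- by move: Sv; rewrite (perm_all _ perm) /= => /andP[].
- move=> i j; rewrite -p'E -srk_cons; apply/permP.
  by rewrite perm_cat ?perm_map.
- move=> x; rewrite mem_cat (perm_mem perm) inE (perm_mem (perm_map _ perm)) inE /=.
  rewrite /symmetrize mem_cat => /orP[/orP[/eqP xp|xS]|/orP[/eqP xp|xS]].
  + by case: p'M => -[Ep Em]; [constructor 2 | constructor 3]; rewrite xp.
  + by constructor 1; rewrite xS.
  + by case: p'M => -[Ep Em]; [constructor 3 | constructor 2]; rewrite xp.
  + by constructor 1; rewrite xS orbT.
Qed.

Section Move.
Variables S T : seq (nat * nat).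
Hypotheses (Sv : all seg_valid S) (Tv : all seg_valid T).
Hypothesis le_TS : forall i j, 1 <= i -> i <= j -> j <= n -> srk T i j <= srk S i j.
Hypothesis eq_TS : forall i, 1 <= i -> i <= n -> srk T i i = srk S i i.
Let a := srk S.
Let b := srk T.

Let le_ba i j : i <= j -> b i j <= a i j.
Proof.
move=> ij; have [out|ijn] : ((i == 0) || (n < j)) \/ (1 <= i /\ j <= n) by lia.
  by rewrite /a /b /srk !mrk_out ?symmetrize_valid.
by apply: le_TS; lia.
Qed.

Let eq_ba i : b i i = a i i.
Proof.
have [out|ijn] : ((i == 0) || (n < i)) \/ (1 <= i /\ i <= n) by lia.
  by rewrite /a /b /srk !mrk_out ?symmetrize_valid.
by apply: eq_TS; lia.
Qed.

Let box i k j l : i <= k -> j <= l ->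
  count (fun p => (i < p.1 <= k) && (j <= p.2 < l)) (symmetrize S) + a i j + a k l =
  a k j + a i l.
Proof. exact: mrk_box. Qed.

Let boxT i k j l : i <= k -> j <= l -> b i j + b k l <= b k j + b i l.
Proof. by move=> ik jl; rewrite /b /srk -(mrk_box _ ik jl); lia. Qed.

(** The other three corners of the cell at a longest pair are longer pairs, where the ranks agree.
    The multiplicity in S thus exceeds that in T by the excess of the ranks. *)
Lemma maximal_segment : (exists i j, [/\ 1 <= i, i <= j, j <= n & b i j < a i j]) ->
  exists t s, [/\ (t, s) \in symmetrize S, t < s & b t s < a t s].
Proof.
case=> i0 [j0 [i1 ij jn ab]].
pose P d := [exists i : 'I_n.+1, exists j : 'I_n.+1,
  [&& 1 <= i, i <= j, j - i == d & b i j < a i j]].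
have [||d /existsP[i /existsP[j /and4P[i1' ij' /eqP dE abd]]] dmax] := @ex_maxnP P n.
- exists (j0 - i0); apply/existsP; exists (inord i0); apply/existsP; exists (inord j0).
  by rewrite !inordK ?i1 ?ij ?eqxx ?ab //; lia.
- by move=> d /existsP[i /existsP[j /and4P[_ _ /eqP <- _]]]; have := ltn_ord j; lia.
have max_eq k l : k <= l -> j - i < l - k -> b k l = a k l.
  move=> kl dkl; apply/eqP; rewrite eqn_leq le_ba //= leqNgt; apply/negP => abk.
  have [out|kln] : ((k == 0) || (n < l)) \/ (1 <= k /\ l <= n) by lia.
    by move: abk; rewrite /a /b /srk !mrk_out ?symmetrize_valid.
  suff /dmax : P (l - k) by lia.
  apply/existsP; exists (inord k); apply/existsP; exists (inord l).
  by rewrite !inordK ?kl ?eqxx ?abk ?andbT //; lia.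
move: {i}(nat_of_ord i) {j}(nat_of_ord j) i1' ij' dE abd max_eq.
move=> i j i1' ij' dE abd max_eq.
have lt_ij : i < j.
  by rewrite ltn_neqAle ij' andbT; apply: contraTneq abd => ->; rewrite eq_ba ltnn.
exists i, j; split=> //.
rewrite -has_pred1 has_count.
have Ei : i.-1.+1 = i by lia.
have := mrk_cell (symmetrize S) i.-1 j; rewrite Ei -/(srk S) -/a => ES.
have := mrk_cell (symmetrize T) i.-1 j; rewrite Ei -/(srk T) -/b => ET.
have e1 : b i.-1 j = a i.-1 j by apply: max_eq; lia.
have e2 : b i j.+1 = a i j.+1 by apply: max_eq; lia.
have e3 : b i.-1 j.+1 = a i.-1 j.+1 by apply: max_eq; lia.
change (0 < count_mem (i, j) (symmetrize S)).
move: (count_mem _ _) (count_mem _ (symmetrize T)) ES ET => cS cT ES ET; lia.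
Qed.

(** These pairs are exactly those where passing from [t,s] + [q,r] to [t,r] + [q,s] lowers the rank,
    each time by one. *)
Definition rect_below t s q r := forall i j, t <= i < q -> r < j <= s -> b i j < a i j.

Definition admissible t s q r := [/\ t < q, q <= r.+1, r < s,
  (q, r) \in symmetrize S \/ q = r.+1 & rect_below t s q r].

(** Take q and then r minimal. If q <= r, minimality gives equality of ranks at (q, s) and at some
    (i0, r), while there is a strict excess at (i0, s). The second difference on this box is then
    positive for S, and any segment counted there has its rectangle inside that of q and r. *)
Lemma admissible_exists t s : t < s -> b t s < a t s -> exists q r, admissible t s q r.
Proof.
move=> ts ab.
have [|q /andP[tq /eqP abq] qmin] := @ex_minnP (fun q => (t < q) && (b q s == a q s)).
  by exists s; rewrite ts eq_ba eqxx.
have q_s : q <= s by apply: qmin; rewrite ts eq_ba eqxx.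
have row i : t <= i < q -> b i s < a i s.
  move=> /andP[ti iq]; rewrite ltn_neqAle le_ba ?andbT; last by lia.
  apply/negP => e; have [it|it] : i = t \/ t < i by lia.
    by move: e; rewrite it => /eqP e; move: ab; rewrite e ltnn.
  by have := qmin i; rewrite it e; lia.
pose P r := [forall i : 'I_q, forall j : 'I_s.+1, (t <= i) && (r < j) ==> (b i j < a i j)].
have PP r : reflect (rect_below t s q r) (P r).
  apply: (iffP forallP) => [H i j /andP[ti iq] /andP[rj js]|H i].
    have /forallP/(_ (Ordinal (js : j < s.+1))) := H (Ordinal iq).
    by rewrite /= ti rj.
  apply/forallP => j; apply/implyP => /andP[ti rj]; apply: H.
    by rewrite ti ltn_ord.
  by rewrite rj -ltnS ltn_ord.
have [|r Pr rmin] := @ex_minnP P.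
  exists s.-1; apply/PP => i j iP jP; have -> : j = s by lia.
  exact: row.
have rs : r < s.
  have /rmin : P s.-1; last by lia.
  apply/PP => i j iP jP; have -> : j = s by lia.
  exact: row.
move/PP: Pr => Pr.
have qr : q <= r.+1.
  rewrite leqNgt; apply/negP => rq.
  have := Pr q.-1 q.-1; rewrite eq_ba ltnn => H.
  by suff : false by []; apply: H; lia.
have [Eqr|qr'] : q = r.+1 \/ q <= r by lia.
  by exists q, r; split=> //; right.
have [i0 [i0P abr]] : exists i0, t <= i0 < q /\ b i0 r = a i0 r.
  have : ~~ P r.-1 by apply/negP => /rmin; lia.
  case/forallPn => i /forallPn[j]; rewrite negb_imply => /andP[/andP[ti rj] nab].
  exists (nat_of_ord i).
  have iq := ltn_ord i; have js := ltn_ord j; split; first by rewrite ti.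
  have [jr|jr] : nat_of_ord j = r \/ r < j by lia.
    rewrite jr in nab; apply/eqP; rewrite eqn_leq (leqNgt (a i r)) nab andbT.
    by apply: le_ba; lia.
  by move: nab; rewrite Pr //; lia.
have : 0 < count (fun p => (i0 < p.1 <= q) && (r <= p.2 < s)) (symmetrize S).
  have i0q : i0 <= q by lia.
  have := box i0q (ltnW rs); have := boxT i0q (ltnW rs).
  by have := row i0 i0P; have := le_ba qr'; lia.
rewrite -has_count => /hasP[[i j] ijS] /= ijP.
have := allP (symmetrize_valid Sv) _ ijS; rewrite /seg_valid /= => ijv.
exists i, j; split; try lia; first by left.
by move=> k l kP lP; apply: Pr; lia.
Qed.

(** A segment strictly inside the range is itself admissible, with a smaller rectangle, so
    [q + (s - r)] descends. *)
Lemma minimal_admissible t s : t < s -> b t s < a t s ->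
  exists q r, admissible t s q r /\
    forall p, p \in symmetrize S -> ~~ ((t < p.1 < q) && (r < p.2 < s)).
Proof.
move=> ts ab; have [q [r qrP]] := admissible_exists ts ab.
have [m] := ubnP (q + (s - r)); elim: m q r qrP => // m IH q r qrP le_m.
have [/hasP[[i j] ijS] /= ijP|/hasPn noS] :=
    boolP (has (fun p => (t < p.1 < q) && (r < p.2 < s)) (symmetrize S)); last first.
  by exists q, r; split=> // p /noS.
have := allP (symmetrize_valid Sv) _ ijS; rewrite /seg_valid /= => ijv.
case: qrP => tq qr rs _ Pr.
apply: (IH i j); last by lia.
split; try lia; first by left.
by move=> k l kP lP; apply: Pr; lia.
Qed.

(* The corners NW and SE of the square spanned by a point of the rectangle
   and its mirror image lie on the axis of symmetry, where all ranks are even. *)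
Lemma rect_overlap t s q r : 1 <= t -> s <= n -> admissible t s q r ->
  (forall p, p \in symmetrize S -> ~~ ((t < p.1 < q) && (r < p.2 < s))) ->
  forall i j, t <= i < q -> r < j <= s ->
    t <= sigma n j < q -> r < sigma n i <= s -> b i j + 2 <= a i j.
Proof.
move=> t1 sn [tq qr rs _ Pr] noS.
have even_lt i j : (i + j = n.+1) -> t <= i < q -> r < j <= s -> b i j + 2 <= a i j.
  move=> ijn iP jP; have := Pr i j iP jP.
  have -> : j = sigma n i by rewrite /sigma; lia.
  have := srk_even Sv (_ : i <= n) (_ : 1 <= i).
  have := srk_even Tv (_ : i <= n) (_ : 1 <= i).
  rewrite -/a -/b => /(_ ltac:(lia) ltac:(lia)) eT /(_ ltac:(lia) ltac:(lia)) eS.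
  by lia.
have main i j : i + j > n.+1 -> t <= i < q -> r < j <= s ->
    t <= sigma n j < q -> r < sigma n i <= s -> b i j + 2 <= a i j.
  move=> ijn iP jP iP' jP'; rewrite leqNgt; apply/negP => ab1.
  have ab0 := Pr i j iP jP.
  have Ea : a (sigma n j) (sigma n i) = a i j by apply: srk_mirror; lia.
  have Eb : b (sigma n j) (sigma n i) = b i j by apply: srk_mirror; lia.
  have ii : sigma n j <= i by rewrite /sigma; lia.
  have jj : sigma n i <= j by rewrite /sigma; lia.
  have := box ii jj; have := boxT ii jj.
  (* With no segment of S in the box, 2 a(i, j) is the sum of [a] at the two axis corners, whereas 2
     b(i, j) is at most that of [b]; each corner adds an excess of 2. *)
  have -> : count (fun p => (sigma n j < p.1 <= i) && (sigma n i <= p.2 < j))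
      (symmetrize S) = 0.
    apply/eqP; rewrite -leqn0 leqNgt -has_count; apply/hasPn => p /noS.
    by lia.
  have := even_lt i (sigma n i) (_ : _) iP jP'.
  have := even_lt (sigma n j) j (_ : _) iP' jP.
  move=> /(_ ltac:(rewrite /sigma; lia)) e1 /(_ ltac:(rewrite /sigma; lia)) e2.
  by lia.
move=> i j iP jP iP' jP'.
have [ijn|[ijn|ijn]] : i + j > n.+1 \/ i + j = n.+1 \/ i + j < n.+1 by lia.
- exact: main.
- exact: even_lt.
have <- : a (sigma n j) (sigma n i) = a i j by apply: srk_mirror; lia.
have <- : b (sigma n j) (sigma n i) = b i j by apply: srk_mirror; lia.
by apply: main; rewrite /sigma in iP' jP' *; lia.
Qed.

End Move.

End Combinatorics.

(** * Symmetric multisegments recovered from symmetric ranks *)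

Section SymmetricLists.
Variable n : nat.

Lemma mrk_cons p L i j : mrk (p :: L) i j = (seg_rk p.1 p.2 i j + mrk L i j)%N.
Proof. by []. Qed.

Lemma mult_mirror L p : all (seg_valid n) L -> seg_valid n p ->
  (forall i j, (1 <= i)%N -> (i <= j)%N -> (j <= n)%N ->
     mrk L i j = mrk L (sigma n j) (sigma n i)) ->
  count_mem (mirror n p) L = count_mem p L.
Proof.
case: p => x y Lv; rewrite /seg_valid /= => pv sym.
have sym' i j : (i <= j)%N -> (j <= n.+1)%N ->
    mrk L i j = mrk L (sigma n j) (sigma n i).
  move=> ij jn; have [out|iP] : ((i == 0) || (n < j))%N \/ (1 <= i /\ j <= n)%N by lia.
    by rewrite !(mrk_out Lv) //; rewrite /sigma; lia.
  by apply: sym; lia.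
have := mrk_cell L x.-1 y; have := mrk_cell L (sigma n y).-1 (sigma n x).
have -> : x.-1.+1 = x by lia.
have -> : (sigma n y).-1.+1 = sigma n y by rewrite /sigma; lia.
rewrite (sym' x y) ?(sym' x.-1 y) ?(sym' x y.+1) ?(sym' x.-1 y.+1); try lia.
have -> : sigma n x.-1 = (sigma n x).+1 by rewrite /sigma; lia.
have -> : sigma n y.+1 = (sigma n y).-1 by rewrite /sigma; lia.
by rewrite /mirror /=; lia.
Qed.

(** In the second difference at an axis cell, two ranks are on the axis, hence even, and the other
    two are mirror images, hence equal. *)
Lemma mult_axis L x : all (seg_valid n) L -> seg_valid n (x, sigma n x) ->
  (forall i j, (1 <= i)%N -> (i <= j)%N -> (j <= n)%N ->
     mrk L i j = mrk L (sigma n j) (sigma n i)) ->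
  (forall i, (1 <= i)%N -> (i <= sigma n i)%N -> ~~ odd (mrk L i (sigma n i))) ->
  ~~ odd (count_mem (x, sigma n x) L).
Proof.
move=> Lv; rewrite /seg_valid /= => pv sym ev.
have E1 : ~~ odd (mrk L x (sigma n x)) by apply: ev; lia.
have sx : sigma n x.-1 = (sigma n x).+1 by rewrite /sigma; lia.
have E2 : ~~ odd (mrk L x.-1 (sigma n x).+1).
  have [x0|x0] : (x.-1 = 0)%N \/ (1 <= x.-1)%N by lia.
    by rewrite (mrk_out Lv) // x0.
  by rewrite -sx; apply: ev => //; rewrite /sigma in pv *; lia.
have E3 : mrk L x.-1 (sigma n x) = mrk L x (sigma n x).+1.
  have [x0|x0] : (x.-1 = 0)%N \/ (1 <= x.-1)%N by lia.
    by rewrite !(mrk_out Lv) //; rewrite /sigma; lia.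
  rewrite sym; try lia.
  by rewrite sx (_ : sigma n (sigma n x) = x) //; rewrite /sigma; lia.
have := mrk_cell L x.-1 (sigma n x); have -> : x.-1.+1 = x by lia.
move: (count_mem _ _) => c; lia.
Qed.

(** Remove a segment together with its mirror image. A self-mirrored segment has even multiplicity,
    so a second copy is there to be removed. *)
Lemma symmetric_list L : all (seg_valid n) L ->
  (forall i j, (1 <= i)%N -> (i <= j)%N -> (j <= n)%N ->
     mrk L i j = mrk L (sigma n j) (sigma n i)) ->
  (forall i, (1 <= i)%N -> (i <= sigma n i)%N -> ~~ odd (mrk L i (sigma n i))) ->
  exists2 S, all (seg_valid n) S & forall i j, mrk L i j = srk n S i j.
Proof.
have [m] := ubnP (size L); elim: m L => // m IH [|p L] szL; first by exists [::].
move=> Lv sym ev; rewrite /= in szL; have /= /andP[pv Lv'] := Lv.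
have mp : mirror n p \in L.
  have c1 := @mult_mirror (p :: L) p Lv pv sym.
  have [mpE|mpE] := eqVneq (mirror n p) p; last first.
    rewrite -has_pred1 has_count; move: c1; rewrite /= eqxx eq_sym (negbTE mpE).
    by rewrite -/(count_mem _ _); lia.
  rewrite mpE; have := @mult_axis (p :: L) p.1 Lv.
  have -> : (p.1, sigma n p.1) = p.
    case: (p) mpE pv => x y; rewrite /mirror /seg_valid /= => -[Ex Ey] pv'.
    by congr (_, _); rewrite /sigma in Ex Ey *; lia.
  move=> /(_ pv sym ev); rewrite /= eqxx -has_pred1 has_count.
  by case: (count _ _).
have perm := perm_to_rem mp.
have E i j : mrk (p :: L) i j = (sym_rk n p i j + mrk (rem (mirror n p) L) i j)%N.
  by rewrite mrk_cons /sym_rk /mrk (permP perm) /= addnA.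
have [||||S Sv SE] := IH (rem (mirror n p) L).
- by have := perm_size perm; rewrite /=; lia.
- by move: Lv'; rewrite (perm_all _ perm) /= => /andP[].
- move=> i j i1 ij jn; have := sym i j i1 ij jn; rewrite !E.
  have := @srk_mirror n [:: p] i j; rewrite /= pv !srk_cons /srk /mrk /= !addn0.
  by move=> /(_ isT ltac:(lia) jn) ->; lia.
- move=> i i1 isi; have := ev i i1 isi; rewrite !E oddD.
  have := @srk_even n [:: p] i; rewrite /= pv srk_cons /srk /mrk /= addn0.
  by rewrite /sigma in isi *; move=> /(_ isT ltac:(lia) i1)/negbTE ->.
exists (p :: S); first by rewrite /= pv Sv.
by move=> i j; rewrite -[LHS]/(mrk (p :: L) i j) E srk_cons SE.
Qed.

End SymmetricLists.

(** * From ranks to cuts and shifts *)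

Section Decomposition.
Variables (F : fieldType) (n : nat).
Implicit Types (X Y Z : qrep F).

Lemma segment_decomposition X : exists2 L, all (seg_valid n) L &
  forall i j, (1 <= i)%N -> (i <= j)%N -> (j <= n)%N -> rk X i j = mrk L i j.
Proof.
have [m] := ubnP (\sum_(1 <= i < n.+1) rk X i i)%N.
elim: m X => // m IH X /ltnSE leXm.
have [X0|] := boolP (all (fun i => rk X i i == 0)%N (iota 1 n)).
  exists [::] => // i j i1 ij jn; apply/eqP; rewrite -leqn0.
  have /allP/(_ i) := X0; rewrite mem_iota => /(_ ltac:(lia))/eqP <-.
  rewrite rk_diag -dimvf -(limg_ker_dim (path_map (qmap X) i (j - i)) fullv).
  exact: leq_addl.
rewrite -has_predC => /hasP[i0]; rewrite mem_iota /= => i0P Xi0.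
have [|i [j [i1 ij jn split_ij]]] := @first_segment F n X i0 _ Xi0; first by lia.
have [Z XZ] := split_ij X (fun _ _ _ _ _ => erefl).
have [rkX lt_ZX] := rk_split i1 ij jn XZ.
have [L Lv LE] := IH Z (leq_trans lt_ZX leXm).
exists ((i, j) :: L); first by rewrite /= Lv /seg_valid /= i1 ij jn.
by move=> k l k1 kl ln; rewrite rkX // mrk_cons LE.
Qed.

Lemma eps_decomposition X (eps : F) : 2%:R != 0 :> F ->
  (odd n /\ eps = -1) \/ (~~ odd n /\ eps = 1) -> is_eps_rep n eps X ->
  exists2 S, all (seg_valid n) S &
  forall i j, (1 <= i)%N -> (i <= j)%N -> (j <= n)%N -> rk X i j = srk n S i j.
Proof.
move=> F2 split_type X_eps; have [L Lv LE] := segment_decomposition X.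
have [||S Sv SE] := symmetric_list Lv.
- move=> i j i1 ij jn; rewrite -!LE //; try by rewrite /sigma; lia.
  exact: eps_rk_sym X_eps _ _ i1 ij jn.
- move=> i i1 isi; rewrite -LE //; last by rewrite /sigma; lia.
  exact: (eps_rk_even F2 split_type).
by exists S => // i j i1 ij jn; rewrite LE.
Qed.

Variable eps : F.
Hypothesis eps2 : eps * eps = 1.

(** Supplies the complementary epsilon-representation required in a cut or shift; the empty segment
    [1, 0] is the zero representation. *)
Fixpoint sym_sum (S : seq (nat * nat)) : qrep F :=
  if S is p :: S' then
    qsum (qsum (segment F p.1 p.2) (segment F (sigma n p.2) (sigma n p.1))) (sym_sum S')
  else segment F 1 0.

Lemma sym_sum_eps S : all (seg_valid n) S -> is_eps_rep n eps (sym_sum S).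
Proof.
elim: S => [|p S IH] /=.
  move=> _.
  have z_bilin i j : bilinear_for (GRing.Scale.Law.clone _ _ *%R _)
    (GRing.Scale.Law.clone _ _ *%R _)
    (fun (x : 'rV[F]_(1 <= i <= 0)%N) (y : 'rV[F]_(1 <= j <= 0)%N) => 0 : F).
    by split=> u k v w; rewrite /= mulr0 addr0.
  exists (fun i j => mkbil (@z_bilin i j)).
    apply/compatible_eps_form; split.
    - by move=> i j _ _ _ x _; apply: rV_bool0; lia.
    - by move=> i j _ _ x y; rewrite !mkbilE mulr0.
    - by move=> i j _ _ _ x y; rewrite mkbilE.
  by move=> i iP x y; rewrite !mkbilE addr0.
move=> /andP[/and3P[p1 pp pn] /IH[c /compatible_eps_form c_eps c_adj]].
have := seg_dual F (n := n) (t := p.1) (s := p.2) p1 pn.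
set W := sym_sum S in c c_eps c_adj *; case: W c c_eps c_adj => W z c c_eps c_adj pd.
exists (hyp_form n eps (seg_pairing F n p.1 p.2) c).
  apply/compatible_eps_form. exact: (hyp_eps_form eps2 pd c_eps).
exact: hyp_in_repform pd c_eps c_adj.
Qed.

Lemma rk_sym_sum S i j : (i <= j)%N -> rk (sym_sum S) i j = srk n S i j.
Proof.
move=> ij; elim: S => [|p S IH] /=.
  by rewrite rk_segment // /seg_rk /srk /mrk /=; lia.
by rewrite !rk_sum !rk_segment // IH srk_cons.
Qed.

Lemma rank_le_c X N S T : all (seg_valid n) S -> all (seg_valid n) T ->
  (forall i j, (1 <= i)%N -> (i <= j)%N -> (j <= n)%N -> rk X i j = srk n S i j) ->
  (forall i j, (1 <= i)%N -> (i <= j)%N -> (j <= n)%N -> rk N i j = srk n T i j) ->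
  (forall i j, (1 <= i)%N -> (i <= j)%N -> (j <= n)%N ->
     (srk n T i j <= srk n S i j)%N) ->
  (forall i, (1 <= i)%N -> (i <= n)%N -> srk n T i i = srk n S i i) ->
  le_c n eps X N.
Proof.
have [m] := ubnP (\sum_(1 <= i < n.+1) \sum_(i <= j < n.+1) srk n S i j)%N.
elim: m X S => // m IH X S /ltnSE leSm Sv Tv XS NT le_TS eq_TS.
have [eqST|] := boolP (all (fun i => all (fun j => srk n T i j == srk n S i j)
    (index_iota i n.+1)) (index_iota 1 n.+1)).
  apply: le_c_iso; apply: qiso_of_rk => i j i1 ij jn; rewrite XS // NT //.
  have /allP/(_ i) := eqST; rewrite mem_index_iota => /(_ ltac:(lia)).
  by move/allP/(_ j); rewrite mem_index_iota => /(_ ltac:(lia))/eqP.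
move=> neqST.
have : exists i j, [/\ 1 <= i, i <= j, j <= n & srk n T i j < srk n S i j]%N.
  move: neqST; rewrite -has_predC => /hasP[k]; rewrite mem_index_iota /= => kP.
  rewrite -has_predC => /hasP[j]; rewrite mem_index_iota /= => jP neq.
  exists k, j; split; try lia.
  by rewrite ltn_neqAle neq le_TS; lia.
move=> /(maximal_segment Sv Tv le_TS eq_TS)[t [s [tsS ts ts_lt]]].
have tsv := allP (symmetrize_valid Sv) _ tsS; rewrite /seg_valid /= in tsv.
have [q [r [adm noS]]] := minimal_admissible Sv Tv le_TS eq_TS ts ts_lt.
have overlap := rect_overlap Sv Tv (_ : 1 <= t)%N (_ : s <= n)%N adm noS.
have {overlap} overlap := overlap ltac:(lia) ltac:(lia).
case: adm => tq qr rs qrS rect.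
have [S1 [S1v S1E S1in]] := symmetrize_extract Sv tsS.
have shiftE i j : (1 <= i)%N -> (i <= j)%N -> (j <= n)%N ->
    (sym_rk n (t, s) i j + sym_rk n (q, r) i j = sym_rk n (t, r) i j + sym_rk n (q, s) i j +
     ((t <= i < q) && (r < j <= s)) + ((t <= sigma n j < q) && (r < sigma n i <= s)))%N.
  have seg_shift k l : (k <= l)%N -> (seg_rk t s k l + seg_rk q r k l =
      seg_rk t r k l + seg_rk q s k l + ((t <= k < q) && (r < l <= s)))%N.
    by rewrite /seg_rk; lia.
  move=> i1 ij jn; have := seg_shift i j ij.
  have := seg_shift (sigma n j) (sigma n i) ltac:(rewrite /sigma; lia).
  rewrite !seg_rk_sigma /sym_rk /=; try lia.
(* Each rectangle costs one, and on their intersection the excess of 2 pays for both. *)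
have Rmir i j : (1 <= i)%N -> (i <= j)%N -> (j <= n)%N ->
    (srk n T i j + ((t <= i < q) && (r < j <= s)) +
      ((t <= sigma n j < q) && (r < sigma n i <= s)) <= srk n S i j)%N.
  move=> i1 ij jn; have le := le_TS i j i1 ij jn.
  have [R1|R1] := boolP ((t <= i < q) && (r < j <= s))%N;
    have [R2|R2] := boolP ((t <= sigma n j < q) && (r < sigma n i <= s))%N; last by lia.
  - move: R1 R2 => /andP[R1 R1'] /andP[R2 R2'].
    by have := overlap i j R1 R1' R2 R2'; lia.
  - by move: R1 => /andP[R1 R1']; have := rect i j R1 R1'; lia.
  - move: R2 => /andP[R2 R2']; have := rect _ _ R2 R2'.
    by rewrite !srk_mirror //; lia.
have [S2 [S2v S2E cutshift]] : exists S2, [/\ all (seg_valid n) S2,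
    forall i j, (i <= j)%N -> srk n S i j =
      (sym_rk n (t, s) i j + sym_rk n (q, r) i j + srk n S2 i j)%N
  & ((q <= r)%N \/ q = r.+1)].
  have [Eq|qr'] : q = r.+1 \/ (q <= r)%N by lia.
    exists S1; split=> //; last by right.
    move=> i j ij; rewrite S1E Eq sym_rk_empty ?addn0 //; lia.
  case: qrS => [qrS|Eq]; last by lia.
  (* Being strictly shorter than [t, s], this segment is neither it nor its mirror image. *)
  have qrS1 : (q, r) \in symmetrize n S1.
    have [//|[Eq Er]|[Eq Er]] := S1in _ qrS; first by lia.
    by rewrite /sigma in Eq Er; lia.
  have [S2 [S2v S2E _]] := symmetrize_extract S1v qrS1.
  exists S2; split=> //; last by left.
  by move=> i j _; rewrite S1E S2E addnA.
pose S' := (t, r) :: (q, s) :: S2.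
have S'v : all (seg_valid n) S' by rewrite /= S2v /seg_valid /=; lia.
have S'E i j : (1 <= i)%N -> (i <= j)%N -> (j <= n)%N -> (srk n S i j = srk n S' i j +
     ((t <= i < q) && (r < j <= s)) + ((t <= sigma n j < q) && (r < sigma n i <= s)))%N.
  by move=> i1 ij jn; rewrite S2E // shiftE // !srk_cons; lia.
pose Z := sym_sum S2.
have Z_eps : is_eps_rep n eps Z by apply: sym_sum_eps.
have le_YN Y : (forall i j, (1 <= i)%N -> (i <= j)%N -> (j <= n)%N ->
    rk Y i j = srk n S' i j) -> le_c n eps Y N.
  move=> YS'; apply: (IH Y S') => //; last first.
  - move=> i i1 iN; have := Rmir i i i1 (leqnn i) iN; rewrite eq_TS // S'E //.
    by lia.
  - by move=> i j i1 ij jn; have := Rmir i j i1 ij jn; rewrite S'E //; lia.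
  apply: leq_trans leSm.
  have le_sum i : (1 <= i < n.+1)%N ->
      (\sum_(i <= j < n.+1) srk n S' i j <= \sum_(i <= j < n.+1) srk n S i j)%N.
    move=> iP; rewrite big_nat_cond [leqRHS]big_nat_cond; apply: leq_sum => j jP.
    by rewrite S'E; lia.
  (* The sum of ranks drops strictly because (t, s) lies in the lowered rectangle. *)
  have lt_sum : (\sum_(t <= j < n.+1) srk n S' t j < \sum_(t <= j < n.+1) srk n S t j)%N.
    rewrite (bigD1_seq s) ?mem_index_iota ?iota_uniq //=; last by lia.
    rewrite [ltnRHS](bigD1_seq s) ?mem_index_iota ?iota_uniq //=; last by lia.
    rewrite -addSn leq_add //; first by rewrite S'E; lia.
    rewrite big_seq_cond [leqRHS]big_seq_cond; apply: leq_sum => j.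
    by rewrite mem_index_iota => jP; rewrite S'E; lia.
  rewrite (bigD1_seq t) ?mem_index_iota ?iota_uniq //=; last by lia.
  rewrite [ltnRHS](bigD1_seq t) ?mem_index_iota ?iota_uniq //=; last by lia.
  rewrite -addSn leq_add //.
  rewrite big_seq_cond [leqRHS]big_seq_cond; apply: leq_sum => j.
  by rewrite mem_index_iota => /andP[jP _]; apply: le_sum.
case: cutshift => [qr'|Eq].
  apply: (le_c_shift (Y := qsum (qsum (qsum (qsum (segment F t r) (segment F q s))
    (segment F (sigma n r) (sigma n t))) (segment F (sigma n s) (sigma n q))) Z)).
    exists t, q, r, s, Z; split=> //; first by split; lia.
      apply: qiso_of_rk => i j i1 ij jn.
      rewrite XS // S2E // !rk_sum !rk_segment // rk_sym_sum // /sym_rk /seg_rk /=.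
      by rewrite !addnA.
    exact: qiso_refl.
  apply: le_YN => i j i1 ij jn.
  rewrite !rk_sum !rk_segment // rk_sym_sum // !srk_cons /sym_rk /seg_rk /=.
  by rewrite !addnA; congr (_ + _)%N; ring.
apply: (le_c_cut (Y := qsum (qsum (qsum (qsum (segment F t r) (segment F q s))
    (segment F (sigma n s) (sigma n q))) (segment F (sigma n r) (sigma n t))) Z)).
  exists t, r, s, Z; split=> //; first by split; lia.
    apply: qiso_of_rk => i j i1 ij jn.
    rewrite XS // S2E // !rk_sum !rk_segment // rk_sym_sum // Eq.
    by rewrite sym_rk_empty ?addn0 //; lia.
  by rewrite -Eq; apply: qiso_refl.
apply: le_YN => i j i1 ij jn.
rewrite !rk_sum !rk_segment // rk_sym_sum // !srk_cons /sym_rk /seg_rk /=.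
by rewrite !addnA; congr (_ + _)%N; ring.
Qed.

End Decomposition.

(** Algebraic closedness provides the square roots and enough parameters on a line; [2 != 0] gives
    the parity of skew ranks and the extraction of roots. *)
Lemma eps_rep_equiv (F : closedFieldType) (n : nat) (eps : F) (V : gspace F)
    (b : gform V) (M N : repvar V) : 2%:R != 0 :> F ->
  (odd n /\ eps = -1) \/ (~~ odd n /\ eps = 1) -> compatible_form n eps b ->
  in_repform n b M -> in_repform n b N ->
  (le_deg n b M N <-> le_c n eps (QRep M) (QRep N)) /\
  (le_c n eps (QRep M) (QRep N) <-> rank_ge n M N).
Proof.
move=> F2 split_type hb hM hN.
have eps2 : eps * eps = 1 by case: split_type => -[_ ->]; rewrite ?mulrNN mulr1.
have b_eps := (compatible_eps_form n eps b).1 hb.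
have c_to_deg : le_c n eps (QRep M) (QRep N) -> le_deg n b M N.
  move=> MN; apply: (le_c_le_deg F2 eps2 b_eps MN) => //; exact: qiso_refl.
have deg_to_rank : le_deg n b M N -> rank_ge n M N.
  move=> MN; split=> [i j i1 ij jn|i iP]; first exact: le_deg_rk MN i1 ij jn.
  by rewrite -[LHS]/(rk (QRep M) i i) -[RHS]/(rk (QRep N) i i) !rk_diag.
have rank_to_c : rank_ge n M N -> le_c n eps (QRep M) (QRep N).
  move=> [MN MN_diag].
  have M_eps : is_eps_rep n eps (QRep M) by exists b.
  have N_eps : is_eps_rep n eps (QRep N) by exists b.
  have [S Sv SE] := eps_decomposition F2 split_type M_eps.
  have [T Tv TE] := eps_decomposition F2 split_type N_eps.
  apply: (rank_le_c eps2 Sv Tv SE TE) => [i j i1 ij jn|i i1 iN].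
    by rewrite -SE // -TE //; apply: MN.
  by rewrite -SE // -TE //; apply/esym/MN_diag; rewrite i1.
by split; split; auto.
Qed.

Theorem theorem2p11 (R : realType) (n : nat) (eps : R[i])
  (hn : (2 <= n)%N)
  (split_type : (odd n /\ eps = -1) \/ (~~ odd n /\ eps = 1))
  (V : nat -> vectType R[i]) (b : gform V)
  (hb : compatible_form n eps b)
  (M N : repvar V)
  (hM : in_repform n b M) (hN : in_repform n b N) :
  (le_deg n b M N <-> le_c n eps (QRep M) (QRep N)) /\
  (le_c n eps (QRep M) (QRep N) <-> rank_ge n M N).
Proof.
by apply: eps_rep_equiv => //; rewrite Num.Theory.pnatr_eq0.
Qed.
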